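(* Let $u^{N,\varepsilon}_\kappa$ be the function defined in the context. For every $p>1$ there are constants $c_0=c_0(p,N,\kappa)>0$ and $\lambda=\lambda(N,\kappa)>0$ such that for all $\varepsilon\in(0,1)$ $$\big|u^{N,\varepsilon}_\kappa(t,x)-u^{N,\varepsilon}_\kappa(s,y)\big|\le c_0|x-y|^{\frac{p-1}{4p}}+\lambda|t-s|$$ for any $s,t\in[0,T]$ and $x,y\in[0,\infty)$ with $|s-t|\vee|x-y|\le1$.
   Context: **Setting.** $T\in(0,\infty)$, $\mathcal O=[0,T)\times(0,\infty)$, $\overline{\mathcal O}=[0,T]\times[0,\infty)$; $r\ge0$, $\bar\alpha>0$ constants; $g,h:\overline{\mathcal O}\to[0,\infty)$ continuous; $(\mathcal L\varphi)(t,x)=\frac{\sigma^2(x)}2\partial_{xx}\varphi+\mu(x)\partial_x\varphi$. $C^{j,k;\gamma}_{loc}(\overline{\mathcal O})$: functions that are $\gamma$-Hölder (parabolic distance), with time derivatives up to order $j$ and space derivatives up to order $k$, on every compact subset of $\overline{\mathcal O}$; $C^{j,k;\gamma}_b(\overline{\mathcal O})$: same on all of $\overline{\mathcal O}$, with the function and derivatives bounded. $C^{1,2;\gamma}_{Loc}(\overline{\mathcal O})$: functions in $C(\overline{\mathcal O})\cap C^{1,2}(\mathcal O)$ whose derivatives are $\gamma$-Hölder on every compact $\mathcal K\subset\mathcal O$. **Assumption (SDE).** $\mu:\mathbb R\to\mathbb R$, $\sigma:\mathbb R\to[0,\infty)$ continuous, $\sigma(x)=\sigma(0)$, $\mu(x)=\mu(0)$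 for $x<0$; (i) $\mu\in C^1((0,\infty))$, Lipschitz on $[0,\infty)$ with constant $D_1$; (ii) $\sigma\in C^1((0,\infty))$ and $|\sigma(x)-\sigma(y)|\le D_\gamma|x-y|^{\gamma_\sigma}$ on $[0,\infty)$ for some $\gamma_\sigma>1/2$; (iii) $\sigma>0$ on $(0,\infty)$ and $|\mu(x)|+\sigma(x)\le D_1(1+|x|)$ on $[0,\infty)$. **Assumption (G).** (i) $g\in C^{1,2;\gamma}_{loc}(\overline{\mathcal O})$, $h\in C^{0,1;\gamma}_{loc}(\overline{\mathcal O})$ for some $\gamma\in(0,1)$, and $g(t,x)-g(s,x)\le K_0(t-s)$, $h(t,x)-h(s,x)\le K_0(t-s)$ for $0\le s\le t\le T$, $x\ge0$; (ii) $|\partial_xg|\le\bar\alpha$; (iii) $0\le h\le K_1(1+|x|^2)$, $0\le g\le K_1(1+|x|)$. With $\Theta:=h+\partial_tg+\mathcal Lg-rg$: (iv) $\Theta$ is locally Lipschitz on $\mathcal O$ and $\Theta\ge-K_2$; (v) $\liminf_{x\to\infty}\Theta(T,x)>0$, $\Theta(T,0)<0$. **Approximating data.** For $N\in\mathbb N$: $g^N\in C^{1,2;\gamma}_b(\overline{\mathcal O})$, $h^N\in C^{0,1;\gamma}_b(\overline{\mathcal O})$, $0\le g^N\le g$, $0\le h^N\le h$, $g^N+h^N\le N$; $g^N=g$ on $\{g\le N-1\}\cap\{0\le x\le N-1\}$, $h^N=h$ on $\{h\le N-1\}\cap\{0\le x\le N-1\}$; $|h^N(t,x)-h^N(s,y)|\le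 L_N(|x-y|+|t-s|)$, $|g^N(t,x)-g^N(s,y)|\le\bar\alpha^N(|x-y|+|t-s|)$, where $\bar\alpha^N\downarrow\bar\alpha$ as $N\to\infty$. For $\kappa\in(0,1)$: $\mu_\kappa,\sigma_\kappa\in C([0,\infty))\cap C^1((0,\infty))$, $|\mu_\kappa|\le\kappa^{-1}$, $\kappa\le\sigma_\kappa\le\kappa^{-1}$, $|\mu_\kappa(x)|+\sigma_\kappa(x)\le D_1(1+|x|)$, $(\mu_\kappa,\sigma_\kappa)\to(\mu,\sigma)$ uniformly on compacts of $[0,\infty)$ as $\kappa\to0$; $\mu_\kappa$ is $D_1$-Lipschitz and $\sigma_\kappa$ is $\gamma_\sigma$-Hölder with constant $D_\gamma$ on $[0,\infty)$. $\mathcal L_\kappa$ is $\mathcal L$ with $(\mu_\kappa,\sigma_\kappa)$ in place of $(\mu,\sigma)$. $N$ and $1/\kappa$ are assumed sufficiently large. **Penalised problem on $\mathcal O$.** For $\varepsilon\in(0,1)$, $\psi_\varepsilon\in C^2(\mathbb R)$ is non-negative, convex, $\psi_\varepsilon=0$ on $(-\infty,0]$, $\psi_\varepsilon>0$ on $(0,\infty)$, $\psi_\varepsilon'\ge0$, $\psi_\varepsilon(y)=\frac{y-\varepsilon}\varepsilon$ for $y\ge2\varepsilon$. For $\delta\in(0,1)$, $u=u^{N,\varepsilon,\delta}_\kappa\in C^{1,2;\gamma}_{Loc}(\overline{\mathcal O})$ is the unique solution of $$(\partial_t+\mathcal L_\kappa-r)u=-h^N-\tfrac1\delta(g^N-u)^++\psi_\varepsilon(|\partial_xu|^2-(\bar\alpha^N)^2)\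 \text{on }\mathcal O,$$ $u(T,x)=g^N(T,x)$ for $x\ge0$, $u(t,0)=g^N(t,0)$ for $t\in[0,T]$, with $0\le u(t,x)\le K_3(1+|x|^2)$, $K_3$ independent of $N,\kappa,\varepsilon,\delta$. **Definition of $u^{N,\varepsilon}_\kappa$.** $u^{N,\varepsilon}_\kappa:=\lim_{n\to\infty}u^{N,\varepsilon,\delta_n}_\kappa$ along a sequence $\delta_n\downarrow0$ (possibly depending on $N,\kappa,\varepsilon$) for which the convergence holds weakly in $W^{1,2;q}(\mathcal K)$ (one weak time and two weak space derivatives in $L^q$, some fixed $q>3$) for every compact $\mathcal K\subset\mathcal O$ and uniformly on every compact subset of $\overline{\mathcal O}$. *)

(* Defs.v *)
From HB Require Import structures.
From mathcomp Require Import all_boot all_order all_algebra.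
From mathcomp Require Import all_classical all_reals all_analysis.
Set Implicit Arguments.
Unset Strict Implicit.
Unset Printing Implicit Defensive.
Import Order.TTheory GRing.Theory Num.Theory.
Import numFieldNormedType.Exports.
Local Open Scope classical_set_scope.
Local Open Scope ring_scope.

(* A point of the time-space plane is a pair z = (t, x), time first. *)

Definition strip {R : realType} (T : R) : set (R * R) :=
  [set z | (0 <= z.1 < T) && (0 < z.2)].

Definition cl_strip {R : realType} (T : R) : set (R * R) :=
  [set z | (0 <= z.1 <= T) && (0 <= z.2)].

(** Derivatives of functions given on the closed strip only.  A function on
    [cl_strip T] is represented by a total function on [R * R] whose values
    outside the strip are irrelevant, so difference quotients only use
    increments that stay in the domain: the derivatives are one-sided at
    t = 0, t = T and x = 0, and the ordinary ones elsewhere. *)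

Definition diff_quotient_at {R : realType} (A : set R) (f : R -> R) (a : R) :=
  (fun s => (f s - f a) / (s - a)) @ within A a^'.

Definition derivable_within {R : realType} (A : set R) (f : R -> R) (a : R) :
  Prop := cvg (diff_quotient_at A f a).

Definition derive_within {R : realType} (A : set R) (f : R -> R) (a : R) : R :=
  lim (diff_quotient_at A f a).

Definition has_dt {R : realType} (T : R) (f : R * R -> R) (z : R * R) : Prop :=
  derivable_within `[0, T] (fun s => f (s, z.2)) z.1.

Definition has_dx {R : realType} (f : R * R -> R) (z : R * R) : Prop :=
  derivable_within `[0, +oo[ (fun y => f (z.1, y)) z.2.

Definition dt {R : realType} (T : R) (f : R * R -> R) (z : R * R) : R :=
  derive_within `[0, T] (fun s => f (s, z.2)) z.1.

Definition dx {R : realType} (f : R * R -> R) (z : R * R) : R :=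
  derive_within `[0, +oo[ (fun y => f (z.1, y)) z.2.

Definition dxx {R : realType} (f : R * R -> R) : R * R -> R := dx (dx f).

Definition has_derivs01 {R : realType} (A : set (R * R)) (f : R * R -> R) :
  Prop := forall z, A z -> has_dx f z.

Definition has_derivs12 {R : realType} (T : R) (A : set (R * R))
    (f : R * R -> R) : Prop :=
  forall z, A z -> [/\ has_dt T f z, has_dx f z & has_dx (dx f) z].

Definition pdist {R : realType} (z w : R * R) : R :=
  Num.sqrt (`|z.1 - w.1| + `|z.2 - w.2| ^+ 2).

Definition hoelder_on {R : realType} (gamma : R) (A : set (R * R))
    (f : R * R -> R) : Prop :=
  exists C, forall z w, A z -> A w -> `|f z - f w| <= C * pdist z w `^ gamma.

Definition bounded_on {R : realType} (A : set (R * R)) (f : R * R -> R) :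
  Prop := exists C, forall z, A z -> `|f z| <= C.

Definition C01_loc {R : realType} (T gamma : R) (f : R * R -> R) : Prop :=
  has_derivs01 (cl_strip T) f /\
  forall K, compact K -> K `<=` cl_strip T ->
    hoelder_on gamma K f /\ hoelder_on gamma K (dx f).

Definition C12_loc {R : realType} (T gamma : R) (f : R * R -> R) : Prop :=
  has_derivs12 T (cl_strip T) f /\
  forall K, compact K -> K `<=` cl_strip T ->
    [/\ hoelder_on gamma K f, hoelder_on gamma K (dt T f),
        hoelder_on gamma K (dx f) & hoelder_on gamma K (dxx f)].

Definition C01_b {R : realType} (T gamma : R) (f : R * R -> R) : Prop :=
  [/\ has_derivs01 (cl_strip T) f,
      hoelder_on gamma (cl_strip T) f /\ hoelder_on gamma (cl_strip T) (dx f)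
    & bounded_on (cl_strip T) f /\ bounded_on (cl_strip T) (dx f)].

Definition C12_b {R : realType} (T gamma : R) (f : R * R -> R) : Prop :=
  [/\ has_derivs12 T (cl_strip T) f,
      [/\ hoelder_on gamma (cl_strip T) f,
          hoelder_on gamma (cl_strip T) (dt T f),
          hoelder_on gamma (cl_strip T) (dx f)
        & hoelder_on gamma (cl_strip T) (dxx f)]
    & [/\ bounded_on (cl_strip T) f, bounded_on (cl_strip T) (dt T f),
          bounded_on (cl_strip T) (dx f) & bounded_on (cl_strip T) (dxx f)]].

Definition C12 {R : realType} (T : R) (f : R * R -> R) : Prop :=
  has_derivs12 T (strip T) f /\
  [/\ {within strip T, continuous f}, {within strip T, continuous (dt T f)},
      {within strip T, continuous (dx f)}
    & {within strip T, continuous (dxx f)}].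

(* C^{1,2;gamma}_Loc, as opposed to C^{1,2;gamma}_loc above: Hoelder
   derivatives away from t = T and x = 0 only. *)
Definition C12_Loc {R : realType} (T gamma : R) (f : R * R -> R) : Prop :=
  [/\ {within cl_strip T, continuous f}, C12 T f
    & forall K, compact K -> K `<=` strip T ->
      [/\ hoelder_on gamma K (dt T f), hoelder_on gamma K (dx f)
        & hoelder_on gamma K (dxx f)]].

Definition C1_pos {R : realType} (f : R -> R) : Prop :=
  forall x : R, 0 < x -> derivable f x 1 /\ {for x, continuous (derive1 f)}.

Definition gen {R : realType} (mu sigma : R -> R) (f : R * R -> R)
    (z : R * R) : R :=
  sigma z.2 ^+ 2 / 2 * dxx f z + mu z.2 * dx f z.

Record sde_assumption {R : realType} (D1 Dg gs : R) (mu sigma : R -> R) :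
    Prop := {
  sde_mu_cont : continuous mu;
  sde_sigma_cont : continuous sigma;
  sde_sigma_ge0 : forall x, 0 <= sigma x;
  sde_neg : forall x, x < 0 -> sigma x = sigma 0 /\ mu x = mu 0;
  sde_mu_C1 : C1_pos mu;
  sde_mu_lip : forall x y, 0 <= x -> 0 <= y ->
    `|mu x - mu y| <= D1 * `|x - y|;
  sde_sigma_C1 : C1_pos sigma;
  sde_gs : 1 / 2 < gs;
  sde_sigma_hoelder : forall x y, 0 <= x -> 0 <= y ->
    `|sigma x - sigma y| <= Dg * `|x - y| `^ gs;
  sde_sigma_gt0 : forall x, 0 < x -> 0 < sigma x;
  sde_growth : forall x, 0 <= x -> `|mu x| + sigma x <= D1 * (1 + `|x|) }.

Definition Theta {R : realType} (T r : R) (mu sigma : R -> R)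
    (g h : R * R -> R) (z : R * R) : R :=
  h z + dt T g z + gen mu sigma g z - r * g z.

Record G_assumption {R : realType} (T r alpha gamma K0 K1 K2 : R)
    (mu sigma : R -> R) (g h : R * R -> R) : Prop := {
  G_g_cont : {within cl_strip T, continuous g};
  G_h_cont : {within cl_strip T, continuous h};
  G_g_loc : C12_loc T gamma g;
  G_h_loc : C01_loc T gamma h;
  G_g_time : forall s t x, 0 <= s -> s <= t -> t <= T -> 0 <= x ->
    g (t, x) - g (s, x) <= K0 * (t - s);
  G_h_time : forall s t x, 0 <= s -> s <= t -> t <= T -> 0 <= x ->
    h (t, x) - h (s, x) <= K0 * (t - s);
  G_g_dx : forall z, cl_strip T z -> `|dx g z| <= alpha;
  G_h_growth : forall z, cl_strip T z -> 0 <= h z <= K1 * (1 + `|z.2| ^+ 2);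
  G_g_growth : forall z, cl_strip T z -> 0 <= g z <= K1 * (1 + `|z.2|);
  G_Theta_lip :
    [locally [lipschitz (Theta T r mu sigma g h z) | z in strip T]];
  G_Theta_ge : forall z, strip T z -> - K2 <= Theta T r mu sigma g h z;
  G_Theta_infty : (0 < limf_einf (fun x : R =>
    (Theta T r mu sigma g h (T, x))%:E) (pinfty_nbhs R))%E;
  G_Theta_0 : Theta T r mu sigma g h (T, 0) < 0 }.

Record approx_payoff {R : realType} (T gamma : R) (g h : R * R -> R) (N : nat)
    (alphaN : R) (gN hN : R * R -> R) : Prop := {
  ap_gN : C12_b T gamma gN;
  ap_hN : C01_b T gamma hN;
  ap_gN_le : forall z, cl_strip T z -> 0 <= gN z <= g z;
  ap_hN_le : forall z, cl_strip T z -> 0 <= hN z <= h z;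
  ap_sum_le : forall z, cl_strip T z -> gN z + hN z <= N%:R;
  ap_gN_eq : forall z, cl_strip T z ->
    g z <= N%:R - 1 -> z.2 <= N%:R - 1 -> gN z = g z;
  ap_hN_eq : forall z, cl_strip T z ->
    h z <= N%:R - 1 -> z.2 <= N%:R - 1 -> hN z = h z;
  ap_hN_lip : exists L, forall z w, cl_strip T z -> cl_strip T w ->
    `|hN z - hN w| <= L * (`|z.2 - w.2| + `|z.1 - w.1|);
  ap_gN_lip : forall z w, cl_strip T z -> cl_strip T w ->
    `|gN z - gN w| <= alphaN * (`|z.2 - w.2| + `|z.1 - w.1|) }.

Record approx_coeff {R : realType} (D1 Dg gs k : R) (muk sigmak : R -> R) :
    Prop := {
  ac_mu_cont : {within `[0, +oo[, continuous muk};
  ac_sigma_cont : {within `[0, +oo[, continuous sigmak};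
  ac_mu_C1 : C1_pos muk;
  ac_sigma_C1 : C1_pos sigmak;
  ac_mu_bound : forall x, 0 <= x -> `|muk x| <= k^-1;
  ac_sigma_bound : forall x, 0 <= x -> k <= sigmak x <= k^-1;
  ac_growth : forall x, 0 <= x -> `|muk x| + sigmak x <= D1 * (1 + `|x|);
  ac_mu_lip : forall x y, 0 <= x -> 0 <= y ->
    `|muk x - muk y| <= D1 * `|x - y|;
  ac_sigma_hoelder : forall x y, 0 <= x -> 0 <= y ->
    `|sigmak x - sigmak y| <= Dg * `|x - y| `^ gs }.

Definition cvg_unif_compacts {R : realType} (fk : R -> R -> R) (f : R -> R) :
  Prop :=
  forall K : set R, compact K -> K `<=` `[0, +oo[ ->
    {uniform K, fk @ 0^'+ --> f}.

Record penalty {R : realType} (e : R) (psi : R -> R) : Prop := {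
  pen_derivable : forall y, derivable psi y 1;
  pen_derivable2 : forall y, derivable (derive1 psi) y 1;
  pen_C2 : continuous (derive1 (derive1 psi));
  pen_ge0 : forall y, 0 <= psi y;
  pen_convex : convex_function [set: R^o] psi;
  pen_eq0 : forall y, y <= 0 -> psi y = 0;
  pen_gt0 : forall y, 0 < y -> 0 < psi y;
  pen_deriv_ge0 : forall y, 0 <= derive1 psi y;
  pen_linear : forall y, 2 * e <= y -> psi y = (y - e) / e }.

Record penalised_solution {R : realType} (T r gamma K3 alphaN : R)
    (muk sigmak : R -> R) (gN hN : R * R -> R) (psi : R -> R) (delta : R)
    (u : R * R -> R) : Prop := {
  ps_class : C12_Loc T gamma u;
  ps_eq : forall z, strip T z ->
    dt T u z + gen muk sigmak u z - r * u z =
    - hN z - delta^-1 * Num.max (gN z - u z) 0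
    + psi (`|dx u z| ^+ 2 - alphaN ^+ 2);
  ps_terminal : forall x, 0 <= x -> u (T, x) = gN (T, x);
  ps_lateral : forall t, 0 <= t <= T -> u (t, 0) = gN (t, 0);
  ps_growth : forall z, cl_strip T z ->
    0 <= u z <= K3 * (1 + `|z.2| ^+ 2) }.

Definition unique_penalised_solution {R : realType} (T r gamma K3 alphaN : R)
    (muk sigmak : R -> R) (gN hN : R * R -> R) (psi : R -> R) (delta : R)
    (u : R * R -> R) : Prop :=
  penalised_solution T r gamma K3 alphaN muk sigmak gN hN psi delta u /\
  forall v,
    penalised_solution T r gamma K3 alphaN muk sigmak gN hN psi delta v ->
    forall z, cl_strip T z -> v z = u z.

Definition leb2 {R : realType} :
    {measure set (measurableTypeR R * measurableTypeR R) -> \bar R} :=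
  (@lebesgue_measure R \x @lebesgue_measure R)%E.

Definition smooth {R : realType} (phi : R * R -> R) : Prop :=
  forall vs : seq (R * R),
    let Dphi := foldr (fun v (f : R * R -> R) => 'D_v f) phi vs in
    continuous Dphi /\ forall z v, derivable Dphi z v.

Definition test_function {R : realType} (A : set (R * R)) (phi : R * R -> R) :
  Prop :=
  smooth phi /\ exists K : set (R * R),
    [/\ compact K, K `<=` A & forall z, ~ K z -> phi z = 0].

Definition Dt {R : realType} (phi : R * R -> R) : R * R -> R :=
  'D_((1, 0) : R * R) phi.

Definition Dx {R : realType} (phi : R * R -> R) : R * R -> R :=
  'D_((0, 1) : R * R) phi.

Definition weak_derivs {R : realType} (A : set (R * R))
    (f ft fx fxx : R * R -> R) : Prop :=
  forall phi, test_function A phi ->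
    [/\ \int[leb2]_(z in A) (f z * Dt phi z) =
          - \int[leb2]_(z in A) (ft z * phi z),
        \int[leb2]_(z in A) (f z * Dx phi z) =
          - \int[leb2]_(z in A) (fx z * phi z)
      & \int[leb2]_(z in A) (f z * Dx (Dx phi) z) =
          \int[leb2]_(z in A) (fxx z * phi z)].

Definition Lq_norm {R : realType} (q : R) (A : set (R * R)) (f : R * R -> R) :
  \bar R := 'N[@leb2 R]_(q%:E)[EFin \o (f \_ A)]%E.

Definition in_Lq {R : realType} (q : R) (A : set (R * R)) (f : R * R -> R) :
  Prop :=
  @measurable_fun _ _ (measurableTypeR R * measurableTypeR R)%type
    (measurableTypeR R) A f /\ (Lq_norm q A f < +oo)%E.

(* For a compact K, membership in W^{1,2;q}(K): f in L^q(K), with weak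
   derivatives, tested on the interior of K, in L^q of that interior. *)
Record W12_derivs {R : realType} (q : R) (K : set (R * R))
    (f ft fx fxx : R * R -> R) : Prop := {
  W12_f : in_Lq q K f;
  W12_ft : in_Lq q K° ft;
  W12_fx : in_Lq q K° fx;
  W12_fxx : in_Lq q K° fxx;
  W12_weak : weak_derivs K° f ft fx fxx }.

Definition W12 {R : realType} (q : R) (K : set (R * R)) (f : R * R -> R) :
  Prop := exists ft fx fxx, W12_derivs q K f ft fx fxx.

(* Continuous linear functionals on W^{1,2;q}(K).  Boundedness by the norm
   makes l depend only on the class of f modulo a.e. equality on K. *)
Definition W12_dual {R : realType} (q : R) (K : set (R * R))
    (l : (R * R -> R) -> R) : Prop :=
  (forall (a : R) f1 f2, W12 q K f1 -> W12 q K f2 ->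
    l (fun z => a * f1 z + f2 z) = a * l f1 + l f2) /\
  exists C : R, forall f ft fx fxx, W12_derivs q K f ft fx fxx ->
    (`|l f|%:E <= C%:E * (Lq_norm q K f + Lq_norm q K° ft
                          + Lq_norm q K° fx + Lq_norm q K° fxx))%E.

Definition weak_cvg_W12 {R : realType} (q : R) (K : set (R * R))
    (fn : nat -> R * R -> R) (f : R * R -> R) : Prop :=
  [/\ forall n, W12 q K (fn n), W12 q K f
    & forall l, W12_dual q K l -> l (fn n) @[n --> \oo] --> l f].

Definition penalised_limit {R : realType} (T q : R) (ud : R -> R * R -> R)
    (u : R * R -> R) : Prop :=
  exists delta : nat -> R,
    [/\ forall n, 0 < delta n < 1, nonincreasing_seq delta,
        delta @ \oo --> (0 : R),
        forall K, compact K -> K `<=` strip T ->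
          weak_cvg_W12 q K (fun n => ud (delta n)) u
      & forall K, compact K -> K `<=` cl_strip T ->
          {uniform K, (fun n => ud (delta n)) @ \oo --> u}].

(* Main.v *)
(** For fixed N and kappa the penalised solutions are Lipschitz in both
    variables, uniformly in epsilon and up to an error O(delta); this is stronger
    than the claimed Hölder bound, and only the pointwise convergence as
    delta -> 0 is needed to pass to the limit.

    - In time: by comparison with g^N(T,x) +- C (T - t) the solution differs from
      its terminal value by at most C (T - t), with C independent of epsilon and
      delta because |d_x g^N| <= alpha^N switches the gradient penalty off.  The
      coefficients do not depend on t, so u(t + s, x) +- s (C + L (T - t)) are
      super- and subsolutions of the same problem, and u is Lipschitz in t.
    - In space: g^N - C delta is a subsolution, so the obstacle term
      (g^N - u)^+ / delta is at most C.  At a fixed time the equation then reads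
      sigma^2/2 u_xx = - mu u_x + psi + O(1) with psi >= 0, hence
      u_xx >= - C' (1 + |u_x|).  As u is bounded, a concave exponential barrier
      turns this one-sided bound into a Lipschitz bound. *)
Require Import Defs.
From HB Require Import structures.
From mathcomp Require Import all_boot all_order all_algebra.
From mathcomp Require Import all_classical all_reals all_analysis.
From mathcomp Require Import ring lra.
Set Implicit Arguments.
Unset Strict Implicit.
Unset Printing Implicit Defensive.
Import Order.TTheory GRing.Theory Num.Theory.
Import numFieldNormedType.Exports.
Local Open Scope classical_set_scope.
Local Open Scope ring_scope.

(** * One-sided derivatives and the parabolic maximum principle *)

(** The quotients of [diff_quotient_at] are indexed by the moving point, those behind [is_derive] by
    the increment. Caratheodory's factorisation [f s - f a = g s * (s - a)] translates between them,
    [g] being the slope function completed by [l] at [a]. *)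
Lemma is_derive_slope {R : realType} (f : R -> R) (a l : R) :
  (f s - f a) / (s - a) @[s --> a^'] --> l <-> is_derive a 1 f l.
Proof.
split => [fl|/is_derive1_caratheodory[g [fg gc <-]]]; last first.
  have /continuous_withinNx gl := gc.
  apply: cvg_trans gl; apply: near_eq_cvg.
  rewrite near_withinE; near=> s => sa.
  by rewrite fg mulfK// subr_eq0.
apply/is_derive1_caratheodory.
exists (fun s => if s == a then l else (f s - f a) / (s - a)); split.
- move=> s; case: eqP => [->|/eqP sa]; first by rewrite !subrr mulr0.
  by rewrite divfK// subr_eq0.
- apply/continuous_withinNx; rewrite eqxx.
  apply: cvg_trans fl; apply: near_eq_cvg.
  rewrite near_withinE; near=> s => sa.
  by rewrite (negbTE sa).
- by rewrite eqxx.
Unshelve. all: by end_near. Qed.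

(** Serves to forget the domain in a difference quotient: with [F = G] at interior points, and with
    [F] the right neighbourhoods and [G] the punctured ones for time derivatives. *)
Lemma cvg_within_near {T : Type} {U : topologicalType} (F G : set_system T)
    (D : set T) (f : T -> U) (l : U) : Filter F ->
  G `<=` F -> F D -> f @ within D G --> l -> f @ F --> l.
Proof.
move=> FF GF FD fl A /fl; rewrite /fmap /within /= => /GF GA.
by change (F (f @^-1` A)); apply: filterS2 FD GA => x Dx; exact.
Qed.

Lemma derive_within_interior {R : realType} (f : R -> R) (x : R) :
  0 < x -> derivable_within `[0, +oo[ f x ->
  is_derive x 1 f (derive_within `[0, +oo[ f x).
Proof.
move=> x0; rewrite /derivable_within /derive_within /diff_quotient_at => fx.
apply/is_derive_slope; apply: (@cvg_within_near _ _ x^' x^' `[0, +oo[) fx => //.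
apply: nbhs_dnbhs; have : x \in `]0, +oo[ by rewrite in_itv/= x0.
move/near_in_itvoy; apply: filterS => y.
by rewrite /= !in_itv/= !andbT => /ltW.
Qed.

(* The time derivative is one-sided so that [t = 0] is included. *)
Definition heat_jet {R : realType} (f : R * R -> R) (z : R * R) (a b c : R) :
    Prop :=
  (f (s, z.2) - f z) / (s - z.1) @[s --> z.1^'+] --> a /\
  exists2 f1 : R -> R,
    (\forall y \near z.2, is_derive (y : R) 1 (fun x => f (z.1, x)) (f1 y)) &
    f1 z.2 = b /\ is_derive z.2 1 f1 c.

Lemma heat_jet_lin {R : realType} (p q : R) (f g : R * R -> R) z a b c a' b' c' :
  heat_jet f z a b c -> heat_jet g z a' b' c' ->
  heat_jet (fun w => p * f w + q * g w) z
    (p * a + q * a') (p * b + q * b') (p * c + q * c').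
Proof.
move=> [fa [f1 ff1 [f1b f1c]]] [ga [g1 gg1 [g1b g1c]]]; split.
- have -> : (fun s => (p * f (s, z.2) + q * g (s, z.2) - (p * f z + q * g z))
      / (s - z.1)) = (fun s => p * ((f (s, z.2) - f z) / (s - z.1))
      + q * ((g (s, z.2) - g z) / (s - z.1))).
    by apply/funext => s; ring.
  by apply: cvgD; apply: cvgMr.
- exists (fun y => p * f1 y + q * g1 y); last first.
    split; first by rewrite f1b g1b.
    by apply: is_derive_eq; rewrite // !scaler0 !addr0.
  near=> y.
  have ? : is_derive y 1 (fun x => f (z.1, x)) (f1 y) by near: y.
  have ? : is_derive y 1 (fun x => g (z.1, x)) (g1 y) by near: y.
  by apply: is_derive_eq; rewrite // !scaler0 !addr0.
Unshelve. all: by end_near. Qed.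

Lemma heat_jet_affine {R : realType} (m p q : R) (z : R * R) :
  heat_jet (fun w => m + p * w.1 + q * w.2) z p q 0.
Proof.
split => /=.
- apply: cvg_near_cst; near=> s.
  have : s - z.1 != 0 by rewrite subr_eq0 gt_eqF//; near: s; exact: nbhs_right_gt.
  by move=> ?; field.
- exists (cst q); last by split => //; exact: is_derive_cst.
  near=> y; apply: is_derive_eq.
  by rewrite /GRing.scale /=; ring.
Unshelve. all: by end_near. Qed.

Lemma heat_jet_exp {R : realType} (k : R) (z : R * R) :
  heat_jet (fun w => expR (w.2 - k * w.1)) z
    (- k * expR (z.2 - k * z.1)) (expR (z.2 - k * z.1)) (expR (z.2 - k * z.1)).
Proof.
split => /=.
- apply: cvg_dnbhs_at_right.
  apply/(is_derive_slope (fun s => expR (z.2 - k * s))).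
  apply: is_derive_eq.
  by rewrite /GRing.scale /=; ring.
- exists (fun y => expR (y - k * z.1)).
    near=> y; apply: is_derive_eq.
    by rewrite /GRing.scale /=; ring.
  split => //; apply: is_derive_eq.
  by rewrite /GRing.scale /=; ring.
Unshelve. all: by end_near. Qed.

Lemma heat_jet_shift {R : realType} (f : R * R -> R) (t x d a b c : R) :
  heat_jet f (t + d, x) a b c ->
  heat_jet (fun w => f (w.1 + d, w.2)) (t, x) a b c.
Proof.
move=> [fa [f1 ff1 f1c]]; split => /=; last by exists f1.
have -> : (fun s => (f (s + d, x) - f (t + d, x)) / (s - t)) =
    (fun s => (f (s, x) - f (t + d, x)) / (s - (t + d))) \o (fun s => s + d).
  by apply/funext => s /=; congr (_ / _); ring.
apply: (@increasing_cvg_at_right_comp R (fun s => s + d)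
  (fun s => (f (s, x) - f (t + d, x)) / (s - (t + d))) t +oo%O a) => //.
- by move=> ? ? _ _; rewrite ltrD2r.
- by apply: cvgD; [exact: cvg_at_right_filter cvg_id | exact: cvg_cst].
Qed.

(** If [c > 0], then [f1], which vanishes at [x], is positive just to the right of [x], and the mean
    value theorem pushes [f] above [f x] there. *)
Lemma second_derivative_max {R : realType} (f f1 : R -> R) (x c : R) :
  (\forall y \near x, is_derive (y : R) 1 f (f1 y)) ->
  (\forall y \near x, f y <= f x) -> is_derive x 1 f1 c ->
  f1 x = 0 /\ c <= 0.
Proof.
move=> /nbhs_ballP[d/= d0 fd] /nbhs_ballP[e/= e0 fe] f1c.
have f1x0 : f1 x = 0.
  have fdx : is_derive x 1 f (f1 x) by apply: fd; exact: ballxx.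
  pose m := Num.min d e.
  have m0 : 0 < m by rewrite lt_min d0.
  have mball t : t \in `]x - m, x + m[ -> `|x - t| < m.
    by rewrite in_itv/= distrC -ltr_distl.
  have : is_derive x 1 f 0.
    apply: (@derive1_at_max _ _ (x - m) (x + m)).
    - by rewrite lerBlDr -addrA lerDl addr_ge0// ltW.
    - move=> t /mball; rewrite lt_min => /andP[td _].
      by have [] : is_derive t 1 f (f1 t) by apply: fd.
    - by rewrite in_itv/= ltrBlDr !ltrDl m0.
    - move=> t /mball; rewrite lt_min => /andP[_ te].
      by apply: fe.
  move=> fd0; rewrite -(@derive_val _ _ _ _ _ _ _ fdx).
  by rewrite (@derive_val _ _ _ _ _ _ _ fd0).
split => //; rewrite leNgt; apply/negP => c0.
move/is_derive_slope : f1c => /cvgr_gt /(_ _ c0).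
rewrite near_withinE => /nbhs_ballP[r/= r0 fr].
(* Halving keeps the endpoint [x + m] strictly inside all three balls. *)
pose m := Num.min (Num.min d e) r / 2.
have m0 : 0 < m by rewrite divr_gt0// !lt_min d0 e0.
have [md me mr] : [/\ m < d, m < e & m < r].
  have mm : m < Num.min (Num.min d e) r.
    by rewrite /m ltr_pdivrMr// mulr_natr mulr2n ltrDl !lt_min d0 e0.
  by move: mm; rewrite !lt_min => /andP[/andP[-> ->] ->].
have xt t : x < t < x + m -> `|x - t| < m.
  by move=> /andP[xt tm]; rewrite distrC gtr0_norm ?subr_gt0// ltrBlDl.
have fdt t : x <= t <= x + m -> is_derive t 1 f (f1 t).
  move=> /andP[xt' tm]; apply: fd; rewrite /ball/= distrC ger0_norm ?subr_ge0//.
  by apply: le_lt_trans md; rewrite lerBlDl.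
have [|||y] := @MVT _ f f1 x (x + m).
- by rewrite ltrDl.
- by move=> t; rewrite in_itv/= => /andP[? ?]; apply: fdt; rewrite !ltW.
- apply: derivable_within_continuous => t; rewrite in_itv/= => tI.
  by have [] := fdt t tI.
rewrite in_itv/= => /andP[xy ym] E.
have : 0 < f1 y.
  have /fr : ball x r y.
    by rewrite /ball/=; apply: lt_trans mr; apply: xt; rewrite xy.
  by rewrite f1x0 subr0 pmulr_lgt0 ?invr_gt0 ?subr_gt0// => -> //; rewrite gt_eqF.
move=> f1y.
have : f (x + m) <= f x.
  by apply: fe; rewrite /ball/= opprD addNKr normrN gtr0_norm.
rewrite -subr_le0 E addrAC subrr add0r.
by rewrite leNgt mulr_gt0.
Qed.

(** Only times after [z.1] are compared, so the time derivative has a sign but need not vanish; this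
    is the sign that suits a problem with terminal data. *)
Lemma heat_jet_max {R : realType} (f : R * R -> R) z a b c (S : R) :
  z.1 < S -> heat_jet f z a b c ->
  (forall s, z.1 <= s <= S -> f (s, z.2) <= f z) ->
  (\forall y \near z.2, f (z.1, y) <= f z) ->
  [/\ a <= 0, b = 0 & c <= 0].
Proof.
case: z => t x /= tS [/= fa [f1 ff1 [<- f1c]]] ft fx.
have [b0 c0] := second_derivative_max ff1 fx f1c.
split => //.
rewrite -(cvg_lim _ fa)//; apply: limr_le; first by apply/cvg_ex; exists a.
near=> s.
have ts : t < s by near: s; exact: nbhs_right_gt.
rewrite pmulr_lle0 ?invr_gt0 ?subr_gt0// subr_le0 ft// (ltW ts)/=.
by near: s; exact: nbhs_right_le.
Unshelve. all: by end_near. Qed.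

Lemma derive_within_right {R : realType} (f : R -> R) (T t : R) :
  0 <= t < T -> derivable_within `[0, T] f t ->
  (f s - f t) / (s - t) @[s --> t^'+] --> derive_within `[0, T] f t.
Proof.
move=> /andP[t0 tT]; rewrite /derivable_within /derive_within /diff_quotient_at => fx.
apply: (@cvg_within_near _ _ t^'+ t^' `[0, T]) fx => //.
  move=> A; rewrite /at_right/dnbhs/within/=; apply: filterS => y Ay ty.
  by apply: Ay; rewrite gt_eqF.
suff : \forall y \near t^'+, 0 <= y <= T.
  by apply: filterS => y; rewrite /= in_itv.
near=> y; apply/andP; split.
  by apply: (le_trans t0); near: y; exact: nbhs_right_ge.
by near: y; exact: nbhs_right_le.
Unshelve. all: by end_near. Qed.

Lemma heat_jet_dx {R : realType} (f : R * R -> R) (t x : R) : 0 < x ->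
  (forall y, 0 < y -> has_dx f (t, y)) -> has_dx (dx f) (t, x) ->
  exists2 f1 : R -> R,
    (\forall y \near x, is_derive (y : R) 1 (fun x => f (t, x)) (f1 y)) &
    f1 x = dx f (t, x) /\ is_derive x 1 f1 (dxx f (t, x)).
Proof.
move=> x0 fx fxx; exists (fun y => dx f (t, y)).
  have : x \in `]0, +oo[ by rewrite in_itv/= x0.
  move/near_in_itvoy; apply: filterS => y; rewrite in_itv/= andbT => y0.
  exact: (@derive_within_interior _ (fun y => f (t, y)) _ y0 (fx _ y0)).
by split => //; exact: (@derive_within_interior _ (fun y => dx f (t, y)) _ x0 fxx).
Qed.

Lemma heat_jet_strip {R : realType} (T : R) (f : R * R -> R) z :
  has_derivs12 T (strip T) f -> strip T z ->
  heat_jet f z (dt T f z) (dx f z) (dxx f z).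
Proof.
case: z => t x Hf zS; have [ft fx fxx] := Hf _ zS.
have /andP[t0 x0] := zS; split => /=.
  exact: derive_within_right t0 ft.
apply: heat_jet_dx => // y y0.
have [] // := Hf (t, y).
by rewrite /strip/= t0.
Qed.

(** The terminal datum frozen in time, from which the barriers near [t = T] are built. *)
Lemma heat_jet_terminal {R : realType} (T : R) (f : R * R -> R) z : 0 <= T ->
  has_derivs12 T (cl_strip T) f -> 0 < z.2 ->
  heat_jet (fun w => f (T, w.2)) z 0 (dx f (T, z.2)) (dxx f (T, z.2)).
Proof.
move=> T0 Hf z0; split => /=.
  by apply: cvg_near_cst; apply: nearW => s; rewrite subrr mul0r.
have Hy y : 0 < y -> cl_strip T (T, y) by move=> y0; rewrite /cl_strip/= T0 lexx ltW.
apply: heat_jet_dx => // [y /Hy/Hf[]//|].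
by have [] := Hf _ (Hy _ z0).
Qed.

(** Beyond [X] the function is nonpositive, so a positive supremum is attained on the compact
    rectangle [K]. The terminal and lateral conditions then force the maximiser into [strip S],
    where time 0 is included. *)
Lemma strip_max {R : realType} (S : R) (w : R * R -> R) (X : R) :
  0 <= S -> 0 <= X -> {within cl_strip S, continuous w} ->
  (forall x, 0 <= x -> w (S, x) <= 0) ->
  (forall t, 0 <= t <= S -> w (t, 0) <= 0) ->
  (forall t x, 0 <= t <= S -> X <= x -> w (t, x) <= 0) ->
  (forall z, strip S z -> 0 < w z ->
     (forall z', cl_strip S z' -> w z' <= w z) -> False) ->
  forall z, cl_strip S z -> w z <= 0.
Proof.
move=> S0 X0 wc wS w0 wX wmax.
pose K : set (R * R) := `[0, S] `*` `[0, X].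
have KS : K `<=` cl_strip S.
  by move=> [t x] [/=]; rewrite !in_itv/= /cl_strip/= => -> /andP[->].
have [|||z zK zmax] := @compact_EVT_max _ R w K.
- by exists (0, 0); split; rewrite /= in_itv/= lexx.
- by apply: compact_setX; exact: segment_compact.
- exact: continuous_subspaceW wc.
move: zK zmax; rewrite inE => zK zmax.
have zle y : cl_strip S y -> w y <= Num.max 0 (w z).
  case: y => t x /andP[/= tS x0]; rewrite le_max.
  have [xX|xX] := leP X x; first by rewrite wX.
  apply/orP; right; apply: zmax; rewrite inE; split => /=; rewrite in_itv//=.
  by rewrite x0 ltW.
move=> y yS; apply: (le_trans (zle y yS)); rewrite ge_max lexx/= leNgt.
apply/negP => wz.
have zS := KS _ zK.
apply: (wmax z) => // [|z' z'S]; last first.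
  by apply: (le_trans (zle _ z'S)); rewrite ge_max lexx ltW.
case: z zS wz {zmax zle zK} => t x /andP[/= /andP[t0 tS] x0] wz.
rewrite /strip/= t0/= !lt_neqAle tS x0 !andbT; apply/andP; split.
  apply/eqP => tE; move: wz; rewrite ltNge => /negP; apply.
  by rewrite tE wS.
apply/eqP => tE; move: wz; rewrite ltNge => /negP; apply.
by rewrite -tE w0// t0.
Qed.

Lemma strip_jet_max {R : realType} (S : R) (w : R * R -> R) z a b c :
  strip S z -> (forall z', cl_strip S z' -> w z' <= w z) ->
  heat_jet w z a b c -> [/\ a <= 0, b = 0 & c <= 0].
Proof.
case: z => t x /andP[/= /andP[t0 tS] x0] wmax wj.
apply: (@heat_jet_max _ w (t, x) a b c S) => //=.
  move=> s /andP[ts sS]; apply: wmax.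
  by rewrite /cl_strip/= (le_trans t0 ts) sS ltW.
have : x \in `]0, +oo[ by rewrite in_itv/= x0.
move/near_in_itvoy; apply: filterS => y; rewrite in_itv/= andbT => y0.
by apply: wmax; rewrite /cl_strip/= t0 !ltW.
Qed.

(** * Comparison principles *)

(* Comparison of [u] with [N (1 + T - t) + eta expR (x - (2 K + 1) t)]: the
   exponential beats the quadratic growth of [u] at infinity, and [eta] is
   arbitrary. *)
Lemma linear_growth_bound {R : realType} (T K N K3 : R) (A B : R -> R)
    (u : R * R -> R) :
  0 <= T -> 0 <= K -> 0 <= N ->
  (forall x, 0 <= x -> 0 <= A x <= K) -> (forall x, 0 <= x -> `|B x| <= K) ->
  {within cl_strip T, continuous u} ->
  (forall x, 0 <= x -> u (T, x) <= N) ->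
  (forall t, 0 <= t <= T -> u (t, 0) <= N) ->
  (forall z, cl_strip T z -> u z <= K3 * (1 + z.2 ^+ 2)) ->
  (forall z, strip T z -> N < u z -> exists a b c, heat_jet u z a b c /\
     - a - A z.2 * c - B z.2 * b <= N) ->
  forall z, cl_strip T z -> u z <= N * (1 + T - z.1).
Proof.
move=> T0 K0 N0 AK BK uc uT u0 ug uj z zT.
apply/ler_addgt0Pr => e e0.
(* At a maximum the diffusion and drift terms cost at most [2 * K] times the exponential; its time
   derivative pays for this with one unit to spare. *)
pose k := 2 * K + 1.
have k0 : 0 <= k by rewrite /k; lra.
pose ph (y : R * R) := expR (y.2 - k * y.1).
(* Normalised so that the exponential term equals [e] at the point [z]. *)
pose eta := e / ph z.
have ph0 y : 0 < ph y by exact: expR_gt0.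
have eta0 : 0 < eta by rewrite divr_gt0.
pose w y := 1 * (1 * u y + (- eta) * ph y) + 1 * (- N * (1 + T) + N * y.1 + 0 * y.2).
suff : w z <= 0.
  rewrite /w /eta mulNr divfK ?gt_eqF// => ?.
  by nra.
(* Since [expR x >= x ^+ 3 / 6], the exponential term is at least [q * x ^+ 3 / 6]. For [x >= X]
   this exceeds [2 * |K3| * x ^+ 2], hence the growth bound on [u]. *)
pose q := eta * expR (- (k * T)).
have q0 : 0 < q by rewrite mulr_gt0// expR_gt0.
pose X := 1 + 12 * `|K3| / q.
have X1 : 1 <= X.
  by rewrite lerDl divr_ge0 ?(ltW q0)//; have := normr_ge0 K3; lra.
have Nt (t : R) : t <= T -> 0 <= N * (T - t) by move=> tT; rewrite mulr_ge0// subr_ge0.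
apply: (@strip_max _ T w X) zT => //.
- by rewrite (le_trans _ X1).
- have phc : continuous ph.
    move=> y; apply: continuous_comp; last exact: continuous_expR.
    apply: cvgB; first exact: cvg_snd.
    by apply: cvgM; [exact: cvg_cst|exact: cvg_fst].
  move=> y; apply: cvgD.
    apply: cvgM; first exact: cvg_cst.
    apply: cvgD; apply: cvgM; [exact: cvg_cst|exact: uc|exact: cvg_cst|].
    by apply: continuous_subspaceT; exact: phc.
  apply: (@continuous_subspaceT _ _ _
    (fun y : R * R => 1 * (- N * (1 + T) + N * y.1 + 0 * y.2))).
  move=> {}y; apply: cvgM; first exact: cvg_cst.
  apply: cvgD; first apply: cvgD; first exact: cvg_cst.
    by apply: cvgM; [exact: cvg_cst|exact: cvg_fst].
  by apply: cvgM; [exact: cvg_cst|exact: cvg_snd].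
- move=> x x0; have := uT x x0; have := mulr_ge0 (ltW eta0) (ltW (ph0 (T, x))).
  by rewrite /w /=; lra.
- move=> t /andP[t0 tT]; have := Nt t tT; rewrite /w /=.
  have := u0 t; rewrite t0 tT => /(_ isT).
  by have := mulr_ge0 (ltW eta0) (ltW (ph0 (t, 0))); lra.
- move=> t x /andP[t0 tT] xX.
  have x1 : 1 <= x by exact: le_trans xX.
  have x0 : 0 <= x by lra.
  have phx : expR (- (k * T)) * (x ^+ 3 / 6) <= ph (t, x).
    apply: (@le_trans _ _ (expR (- (k * T)) * expR x)).
      rewrite ler_pM2l ?expR_gt0//; have := @expR_ge1Dxn _ x 2 x0.
      by rewrite (_ : 3`! = 6)//; lra.
    rewrite -expRD ler_expR /= addrC lerD2l lerN2.
    by rewrite ler_wpM2l.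
  have : q * (x ^+ 3 / 6) <= eta * ph (t, x) by rewrite /q -mulrA ler_pM2l.
  have : u (t, x) <= K3 * (1 + x ^+ 2) by apply: ug; rewrite /cl_strip/= t0 tT.
  have Kx : 12 * `|K3| <= q * x.
    have : 12 * `|K3| / q <= x by rewrite (le_trans _ xX)// lerDr.
    by rewrite ler_pdivrMr// (mulrC q).
  have : 12 * `|K3| * x ^+ 2 <= q * x ^+ 3.
    have -> : q * x ^+ 3 = q * x * x ^+ 2 by ring.
    by rewrite ler_wpM2r// sqr_ge0.
  have : K3 * (1 + x ^+ 2) <= `|K3| * (1 + x ^+ 2).
    by rewrite ler_wpM2r ?ler_norm// addr_ge0// sqr_ge0.
  have : `|K3| * 1 <= `|K3| * x ^+ 2 by rewrite ler_wpM2l// exprn_ege1.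
  by have := Nt t tT; rewrite /w /=; nra.
- move=> y yS wy wmax.
  have /andP[/andP[/= y10 y1T] y20] := yS.
  have phe := mulr_gt0 eta0 (ph0 y).
  have yN : N < u y.
    by have := Nt y.1 (ltW y1T); move: wy; rewrite /w; nra.
  have [a [b [c [uabc uN]]]] := uj y yS yN.
  have wj := heat_jet_lin 1 1 (heat_jet_lin 1 (- eta) uabc (heat_jet_exp k y))
    (heat_jet_affine (- N * (1 + T)) N 0 y).
  have [] := strip_jet_max yS wmax wj.
  rewrite -/(ph y) => at0 bx cx.
  have /andP[A0 A1] := AK _ (ltW y20).
  have := BK _ (ltW y20); rewrite ler_norml => /andP[B0 B1].
  have bE : b = eta * ph y by lra.
  have cE : c <= eta * ph y by lra.
  have := ler_wpM2l A0 cE.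
  move: phe at0 uN; rewrite bE /k; set p := eta * ph y => p0.
  have : - eta * (- (2 * K + 1) * ph y) = (2 * K + 1) * p by rewrite /p; ring.
  move=> at0 at1 uN Ap.
  have : B y.2 * p <= K * p by rewrite ler_pM2r.
  have : A y.2 * p <= K * p by rewrite ler_pM2r.
  by lra.
Qed.

(** The equation with all terms on one side, signed so that subsolutions give values [<= 0]. [A]
    stands for half the squared volatility, [B] for the drift, and [H] for the gradient penalty as a
    function of the slope. *)
Definition penalised_op {R : realType} (r delta : R) (A B : R -> R)
    (g h : R * R -> R) (H : R -> R) (z : R * R) (v a b c : R) : R :=
  - a - A z.2 * c - B z.2 * b + r * v - h z
  - delta^-1 * Num.max (g z - v) 0 + H b.

(* [H] grows superlinearly, so an additive perturbation of [u2] cannot be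
   absorbed.  Since [H] is convex, [theta u1 + (1 - theta) chi] is a strict
   subsolution, where [chi := - (M + c0 (x + (K + 1) (S - t)))] has slope
   [- c0] with [H (- c0) <= 0] and tends to [-oo]. *)
Lemma comparison_principle {R : realType} (S r delta K M c0 : R)
    (A B : R -> R) (g h : R * R -> R) (H : R -> R) (u1 u2 : R * R -> R) :
  0 <= S -> 0 <= r -> 0 < delta -> 0 < c0 -> 0 <= M -> 0 <= K ->
  (forall x, 0 <= x -> 0 <= A x) -> (forall x, 0 <= x -> `|B x| <= K) ->
  (forall z, strip S z -> 0 <= g z /\ 0 <= h z) ->
  H (- c0) <= 0 ->
  (forall th p q, 0 <= th <= 1 ->
     H (th * p + (1 - th) * q) <= th * H p + (1 - th) * H q) ->
  {within cl_strip S, continuous u1} -> {within cl_strip S, continuous u2} ->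
  (forall z, cl_strip S z -> `|u1 z| <= M /\ `|u2 z| <= M) ->
  (forall x, 0 <= x -> u1 (S, x) <= u2 (S, x)) ->
  (forall t, 0 <= t <= S -> u1 (t, 0) <= u2 (t, 0)) ->
  (forall z, strip S z -> exists a b c, heat_jet u1 z a b c /\
     penalised_op r delta A B g h H z (u1 z) a b c <= 0) ->
  (forall z, strip S z -> exists a b c, heat_jet u2 z a b c /\
     0 <= penalised_op r delta A B g h H z (u2 z) a b c) ->
  forall z, cl_strip S z -> u1 z <= u2 z.
Proof.
move=> S0 r0 d0 c00 M0 K0 A0 BK gh0 Hc Hconv u1c u2c uM uS u0 sub sup z zS.
apply/ler_addgt0Pr => e e0.
have /andP[/andP[z0 zS1] zx0] := zS.
(* With [y = 1 - theta], passing from [u1] to the convex combination changes the value at [z] by at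
   most [y * Q], so [y] is chosen to make this at most [e]. *)
pose Q := 2 * M + c0 * (z.2 + (K + 1) * (S - z.1)).
have Q0 : 0 <= Q.
  by rewrite /Q addr_ge0 ?mulr_ge0 ?addr_ge0 ?mulr_ge0 ?subr_ge0//; lra.
have [y [y0 y1 yQ]] : exists y, [/\ 0 < y, y <= 1 & y * Q <= e].
  exists (e / (e + Q)); split.
  - by rewrite divr_gt0// ltr_wpDr.
  - by rewrite ler_pdivrMr ?ltr_wpDr// mul1r lerDl.
  - by rewrite mulrAC ler_pdivrMr ?ltr_wpDr// ler_pM2l// lerDr ltW.
have [th thE] : exists th, th = 1 - y by exists (1 - y).
have yE : 1 - th = y by rewrite thE; ring.
have th01 : 0 <= th <= 1 by lra.
have /andP[th0 th1] := th01.
pose p := y * c0 * (K + 1).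
pose w v := 1 * (th * u1 v + (- 1) * u2 v)
  + 1 * (- (y * M + p * S) + p * v.1 + (- (y * c0)) * v.2).
have yM := mulr_ge0 (ltW y0) M0.
have yc := mulr_gt0 y0 c00.
have p0 : 0 <= p by rewrite /p mulr_ge0 ?ltW//; lra.
have pS t : t <= S -> 0 <= p * (S - t) by move=> ?; rewrite mulr_ge0// subr_ge0.
have bd v : cl_strip S v -> u1 v <= u2 v -> w v <= 0.
  move=> vS uv; have [+ _] := uM _ vS; rewrite ler_norml => /andP[uM1 uM2].
  have /andP[/andP[_ vS1] v0] := vS.
  have : - (y * M) <= y * u1 v by rewrite -mulrN ler_pM2l.
  have := pS _ vS1; have := mulr_ge0 (ltW yc) v0.
  by rewrite /w thE; lra.
suff : w z <= 0.
  have [+ _] := uM _ zS; rewrite ler_norml => /andP[uM1 uM2].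
  have : y * u1 z <= y * M by rewrite ler_pM2l.
  by move: yQ; rewrite /w /Q thE /p; nra.
(* From here on the linear decay of the combination outweighs the bound [2 * M] on the difference of
   the two functions. *)
pose X := 2 * M / (y * c0).
have X0 : 0 <= X by rewrite divr_ge0 ?(ltW yc)//; lra.
apply: (@strip_max _ S w X) zS => //.
- move=> v; apply: cvgD.
    apply: cvgM; first exact: cvg_cst.
    by apply: cvgD; apply: cvgM; [exact: cvg_cst|exact: u1c|exact: cvg_cst|exact: u2c].
  apply: (@continuous_subspaceT _ _ _ (fun v : R * R =>
    1 * (- (y * M + p * S) + p * v.1 + (- (y * c0)) * v.2))).
  move=> {}v; apply: cvgM; first exact: cvg_cst.
  apply: cvgD; first apply: cvgD; first exact: cvg_cst.
    by apply: cvgM; [exact: cvg_cst|exact: cvg_fst].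
  by apply: cvgM; [exact: cvg_cst|exact: cvg_snd].
- by move=> x x0; apply: bd; [rewrite /cl_strip/= S0 lexx|exact: uS].
- by move=> t tS; apply: bd; [rewrite /cl_strip/= tS lexx|exact: u0].
- move=> t x tS Xx; have /andP[t0 tS1] := tS.
  have [] := uM (t, x); first by rewrite /cl_strip/= tS (le_trans X0).
  rewrite !ler_norml => /andP[a1 a2] /andP[b1 b2].
  have : 2 * M <= y * c0 * x by rewrite (mulrC (y * c0)) -ler_pdivrMr.
  have : th * u1 (t, x) <= M.
    have : th * u1 (t, x) <= th * M by rewrite ler_wpM2l.
    by have := ler_wpM2r M0 th1; lra.
  by have := pS _ tS1; rewrite /w /=; lra.
- move=> v vS wv wmax.
  have /andP[/andP[/= v10 v1S] v20] := vS.
  have uv : u2 v < th * u1 v.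
    have := pS _ (ltW v1S); have := mulr_gt0 yc v20.
    by move: wv; rewrite /w; lra.
  have [a1 [b1 [c1 [j1]]]] := sub v vS; have [a2 [b2 [c2 [j2]]]] := sup v vS.
  have := strip_jet_max vS wmax (heat_jet_lin 1 1 (heat_jet_lin th (- 1) j1 j2)
    (heat_jet_affine (- (y * M + p * S)) p (- (y * c0)) v)).
  move=> [ha hb hc] s2 s1.
  have [g0 h0] := gh0 v vS.
  (* The slope of [w] vanishes at the maximum, so the slope of [u2] is the convex combination of
     [b1] and [- c0]; convexity and [H (- c0) <= 0] then control the penalty. *)
  have bE : b2 = th * b1 + (1 - th) * (- c0) by rewrite yE; lra.
  have HH : H b2 <= th * H b1.
    rewrite bE; apply: (le_trans (Hconv th b1 (- c0) th01)).
    by rewrite gerDl yE pmulr_rle0.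
  (* From [0 <= g] and [u2 v < th * u1 v] follows [th * (g v - u1 v) <= g v - u2 v]. *)
  have mm : th * Num.max (g v - u1 v) 0 <= Num.max (g v - u2 v) 0.
    rewrite -(ler_pM2l y0) maxEle; case: ifP => _; rewrite ?mulr0.
      by rewrite mulr_ge0 ?(ltW y0)// le_max lexx orbT.
    rewrite ler_pM2l// le_max; apply/orP; left.
    by have := ler_wpM2r g0 th1; lra.
  have dm : 0 <= delta^-1 * (Num.max (g v - u2 v) 0 - th * Num.max (g v - u1 v) 0).
    by rewrite mulr_ge0 ?invr_ge0 ?(ltW d0)// subr_ge0.
  have yh := mulr_ge0 (ltW y0) h0.
  have ru : 0 <= r * (th * u1 v - u2 v) by rewrite mulr_ge0// subr_ge0 ltW.
  have Ac : A v.2 * (th * c1 - c2) <= 0.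
    by rewrite mulr_ge0_le0 ?A0 ?(ltW v20)//; lra.
  have Bb : B v.2 * (y * c0) <= K * (y * c0).
    by rewrite ler_pM2r//; have := BK _ (ltW v20); rewrite ler_norml => /andP[].
  have s1' := ler_wpM2l th0 s1.
  (* The time slope [p] covers the drift cost [K * (y * c0)] of the slope [- c0] and leaves the
     strict surplus [y * c0], which is the contradiction. *)
  have pE : p = K * (y * c0) + y * c0 by rewrite /p; ring.
  have BE : B v.2 * b2 = th * (B v.2 * b1) - B v.2 * (y * c0).
    by rewrite bE yE; ring.
  have yhE : th * h v = h v - y * h v by rewrite thE; ring.
  clear - s1' s2 pE BE yhE HH dm yh ru Ac Bb ha yc.
  move: s1' s2 BE pE; rewrite /penalised_op => s1 s2 BE pE.
  lra.
Qed.

(** * A one-dimensional gradient bound *)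

(** At an interior maximum of [f - w] the slopes agree and [f'' <= w''], whereas the two
    differential inequalities, read at the same slope, give [w'' < f'']. *)
Lemma concave_barrier {R : realType} (a b C : R) (f f1 f2 w w1 w2 : R -> R) :
  a <= b -> {within `[a, b], continuous f} -> continuous w ->
  f a <= w a -> f b <= w b ->
  (forall y : R, a < y < b -> [/\ \forall x \near y, is_derive (x : R) 1 f (f1 x),
     is_derive y 1 f1 (f2 y) & - (C * (1 + `|f1 y|)) <= f2 y]) ->
  (forall y : R, is_derive y 1 w (w1 y)) ->
  (forall y : R, is_derive y 1 w1 (w2 y)) ->
  (forall y, a < y < b -> w2 y < - (C * (1 + `|w1 y|))) ->
  forall y, a <= y <= b -> f y <= w y.
Proof.
move=> ab fc wc fa fb ff ww ww1 wC y yab.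
have [m mab mmax] : exists2 m, m \in `[a, b] &
    forall t, t \in `[a, b] -> f t - w t <= f m - w m.
  apply: (@EVT_max _ (fun t => f t - w t)) => // t.
  apply: cvgB; first exact: fc.
  by apply: continuous_subspaceT; exact: wc.
have : f y - w y <= f m - w m by apply: mmax; rewrite in_itv.
move=> /le_trans fwy; rewrite -subr_le0; apply: fwy.
move: mab; rewrite in_itv/= => /andP[am mb].
have [-> //|ma] := eqVneq m a; first by rewrite subr_le0.
have [-> //|mb'] := eqVneq m b; first by rewrite subr_le0.
have amb : a < m < b by rewrite !lt_neqAle eq_sym ma am mb' mb.
have [mf mf1 f2C] := ff m amb.
have := wC m amb.
have [] := @second_derivative_max _ (fun t => f t - w t) (fun t => f1 t - w1 t)
  m (f2 m - w2 m).
- near=> x.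
  have ? : is_derive x 1 f (f1 x) by near: x.
  have ? := ww x.
  exact: is_deriveB.
- have : m \in `]a, b[ by rewrite in_itv.
  move/near_in_itvoo; apply: filterS => x xab; apply: mmax.
  exact: subset_itv_oo_cc.
move=> /subr0_eq <- ? ?.
lra.
Unshelve. all: by end_near. Qed.

(* [f'' >= - C (1 + |f'|)] only bounds [f'] when one can travel a unit distance
   in the direction in which [f] increases; to the left of a point close to [0]
   this is replaced by the lower bound [f 0 - alpha y - E] on [f]. *)
Lemma semiconvex_lipschitz {R : realType} (C M alpha E : R) (f f1 f2 : R -> R) :
  0 <= C -> 0 <= alpha -> 0 <= E ->
  {within `[0, +oo[, continuous f} ->
  (forall y, 0 <= y -> 0 <= f y <= M) ->
  (forall y, 0 <= y -> f 0 <= f y + alpha * y + E) ->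
  (forall y : R, 0 < y -> [/\ \forall x \near y, is_derive (x : R) 1 f (f1 x),
     is_derive y 1 f1 (f2 y) & - (C * (1 + `|f1 y|)) <= f2 y]) ->
  forall x y, 0 <= x -> 0 <= y -> `|x - y| <= 1 ->
  `|f x - f y| <= (M + C + 1 + alpha) * expR (C + 1) * `|x - y| + E.
Proof.
move=> C0 al0 E0 fc fM f0 ff.
have M0 : 0 <= M by have /andP[/le_trans] := fM 0 (lexx _); apply.
(* [P0] exceeds [C], for the strict differential inequality; [M], to clear the bound on [f] after a
   unit distance; and [alpha], to clear the line through the value at 0. The factor [expR B] keeps
   the slope of [W] above [P0] on the unit interval. *)
pose B := C + 1; pose P0 := M + C + 1 + alpha; pose P := P0 * expR B.
have B0 : 0 < B by rewrite /B; lra.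
have P00 : 0 < P0 by rewrite /P0; lra.
have P0' : 0 < P by rewrite mulr_gt0// expR_gt0.
(* [W] solves [W'' = - B * W'] with [W 0 = 0] and initial slope [P]. As [B = C + 1] and
   [W' >= P0 > C] on the unit interval, [W'' < - C * (1 + W')] there. *)
pose W d := P / B * (1 - expR (- (B * d))).
have WP d : 0 <= d -> W d <= P * d.
  move=> d0; have -> : P * d = P / B * (B * d) by field; rewrite gt_eqF.
  rewrite ler_pM2l ?divr_gt0//.
  by have := expR_ge1Dx (- (B * d)); lra.
have slope d : 0 <= d <= 1 -> P0 <= P * expR (- (B * d)).
  move=> /andP[d0 d1]; rewrite -mulrA -expRD ler_peMr ?(ltW P00)//.
  rewrite -expR0 ler_expR.
  by have := ler_wpM2l (ltW B0) d1; lra.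
have WP0 d : 0 <= d <= 1 -> P0 * d <= W d.
  move=> d01; have /andP[d0 d1] := d01.
  apply: (@le_trans _ _ (P * expR (- (B * d)) * d)).
    by rewrite ler_wpM2r// slope.
  have -> : P * expR (- (B * d)) * d = P / B * (expR (- (B * d)) * (B * d)).
    by field; rewrite gt_eqF.
  rewrite ler_pM2l ?divr_gt0//.
  have : expR (- (B * d)) * (1 + B * d) <= expR (- (B * d)) * expR (B * d).
    by rewrite ler_pM2l ?expR_gt0// expR_ge1Dx.
  by rewrite -expRD addNr expR0; lra.
pose w1 d := P * expR (- (B * d)).
have Wd (d : R) : is_derive d 1 W (w1 d).
  by apply: is_derive_eq; rewrite /GRing.scale/= /w1; field; rewrite gt_eqF.
have w1d (d : R) : is_derive d 1 w1 (- B * w1 d).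
  by apply: is_derive_eq; rewrite /GRing.scale/= /w1; ring.
have wC d : 0 <= d <= 1 -> - B * w1 d < - (C * (1 + w1 d)).
  by move=> /slope; rewrite -/(w1 d) /P0 /B; lra.
have W00 : W 0 = 0 by rewrite /W mulr0 oppr0 expR0 subrr mulr0.
have fcab a b : 0 <= a -> {within `[a, b], continuous f}.
  move=> a0; apply: continuous_subspaceW fc => x /=; rewrite !in_itv/= andbT.
  by move=> /andP[ax _]; exact: le_trans ax.
have right y d : 0 <= y -> 0 <= d <= 1 -> f (y + d) <= f y + W d.
  move=> y0 /andP[d0 d1].
  pose w t := f y + W (t - y).
  have wd (t : R) : is_derive t 1 w (w1 (t - y)).
    rewrite /w /W; apply: is_derive_eq.
    by rewrite /GRing.scale/= /w1; field; rewrite gt_eqF.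
  have w1d' (t : R) : is_derive t 1 (fun t => w1 (t - y)) (- B * w1 (t - y)).
    rewrite /w1; apply: is_derive_eq.
    by rewrite /GRing.scale/= /w1; ring.
  have -> : f y + W d = w (y + d) by rewrite /w addrAC subrr add0r.
  apply: (@concave_barrier _ y (y + 1) C f f1 f2 w _ _ _ _ _ _ _ _ wd w1d').
  - by rewrite lerDl.
  - exact: fcab.
  - by move=> t; apply/differentiable_continuous/derivable1_diffP; have [] := wd t.
  - by rewrite /w subrr W00 addr0.
  - rewrite /w addrAC subrr add0r.
    have /andP[_ fM1] : 0 <= f (y + 1) <= M by apply: fM; lra.
    have /andP[f0y _] := fM y y0.
    have : P0 * 1 <= W 1 by apply: WP0; rewrite ler01 lexx.
    by rewrite /P0; lra.
  - by move=> t /andP[yt _]; apply: ff; lra.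
  - move=> t /andP[yt ty]; rewrite (ger0_norm (ltW _)).
      by apply: wC; lra.
    by rewrite /w1 mulr_gt0// expR_gt0.
  - by rewrite lerDl d0 lerD2l.
have left y d : 0 <= y -> 0 <= d <= 1 -> d <= y -> f (y - d) <= f y + W d + E.
  move=> y0 /andP[d0 d1] dy.
  (* The reflected barrier: the differential inequality involves only the modulus of the slope. The
     shift by [E] is used when the interval is cut off at 0. *)
  pose w t := f y + E + W (y - t).
  have wd (t : R) : is_derive t 1 w (- w1 (y - t)).
    rewrite /w /W; apply: is_derive_eq.
    by rewrite /GRing.scale/= /w1; field; rewrite gt_eqF.
  have w1d' (t : R) : is_derive t 1 (fun t => - w1 (y - t)) (- B * w1 (y - t)).
    rewrite /w1; apply: is_derive_eq.
    by rewrite /GRing.scale/= /w1; ring.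
  have -> : f y + W d + E = w (y - d) by rewrite /w subKr addrAC.
  (* If a unit step to the left fits, [W 1 >= M] settles the endpoint [l]; otherwise [l = 0] and the
     bound on [f 0] does. *)
  pose l := Num.max 0 (y - 1).
  have [l0 ly yl1] : [/\ 0 <= l, l <= y & y - l <= 1].
    by rewrite /l maxEle; case: ifP => ?; split; lra.
  apply: (@concave_barrier _ l y C f f1 f2 w _ _ _ _ _ _ _ _ wd w1d').
  - by [].
  - exact: fcab.
  - by move=> t; apply/differentiable_continuous/derivable1_diffP; have [] := wd t.
  - have lE : l = 0 \/ l = y - 1 by rewrite /l maxEle; case: ifP => _; [right|left].
    have /andP[f0y _] := fM y y0.
    have yl01 : 0 <= y - l <= 1 by lra.
    have := WP0 _ yl01.
    case: lE => lE; rewrite /w lE.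
      rewrite subr0 => WPy.
      have : alpha * y <= P0 * y by rewrite ler_wpM2r// /P0; lra.
      by have := f0 y y0; lra.
    have -> : y - (y - 1) = 1 by ring.
    have /andP[_ +] : 0 <= f (y - 1) <= M by apply: fM; lra.
    by rewrite /P0; lra.
  - by rewrite /w subrr W00 addr0 lerDl.
  - by move=> t /andP[lt _]; apply: ff; lra.
  - move=> t /andP[lt ty]; rewrite normrN (ger0_norm (ltW _)).
      by apply: wC; lra.
    by rewrite /w1 mulr_gt0// expR_gt0.
  - by rewrite /l ge_max; lra.
have main x y : 0 <= x -> x <= y -> y <= x + 1 ->
    `|f x - f y| <= P * (y - x) + E.
  move=> x0 xy yx; have d0 : 0 <= y - x by lra.
  have d01 : 0 <= y - x <= 1 by lra.
  have := right x (y - x) x0 d01; rewrite addrC subrK => r1.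
  have := left y (y - x) (le_trans x0 xy) d01; rewrite subKr => l1.
  have := WP _ d0; have := l1 ltac:(lra).
  by rewrite ler_distl; lra.
move=> x y x0 y0; case: (leP x y) => xy.
  rewrite distrC ger0_norm ?subr_ge0// distrC => ?.
  by rewrite distrC; apply: main => //; lra.
rewrite ger0_norm ?subr_ge0 ?(ltW xy)// => ?.
by rewrite distrC; apply: main => //; lra.
Qed.

(** * Estimates uniform in the penalisation parameters *)

Lemma heat_jet_addt {R : realType} (m p : R) (f : R * R -> R) z a b c :
  heat_jet f z a b c ->
  heat_jet (fun w => f w + (m + p * w.1)) z (a + p) b c.
Proof.
move=> fj; have := heat_jet_lin 1 1 fj (heat_jet_affine m p 0 z).
rewrite !mul1r !addr0; congr heat_jet.
by apply/funext => w; ring.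
Qed.

Lemma continuous_within_comp {T U V : topologicalType} (A : set T) (B : set U)
    (phi : T -> U) (f : U -> V) :
  (forall x, A x -> B (phi x)) -> continuous phi ->
  {within B, continuous f} -> {within A, continuous (f \o phi)}.
Proof.
move=> AB phic /subspace_continuousP fc; apply/subspace_continuousP => x Ax.
apply: cvg_comp (fc _ (AB _ Ax)) => P; rewrite /within /= => /phic phiP.
change (nbhs x (fun y => A y -> P (phi y))).
apply: (@filterS _ _ _ (fun y => B (phi y) -> P (phi y))) phiP => y By Ay.
by apply: By; exact: AB.
Qed.

Lemma lipschitz_within_continuous {R : realType} (S L : R) (f : R * R -> R) :
  (forall z w, cl_strip S z -> cl_strip S w ->
     `|f z - f w| <= L * (`|z.2 - w.2| + `|z.1 - w.1|)) ->
  {within cl_strip S, continuous f}.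
Proof.
move=> fL; apply/subspace_continuousP => z zS; apply/cvgrPdist_lt => e e0.
rewrite near_withinE.
pose d (w : R * R) := L * (`|z.2 - w.2| + `|z.1 - w.1|).
have dc : d w @[w --> z] --> d z.
  apply: cvgM; first exact: cvg_cst.
  by apply: cvgD; apply: cvg_norm; apply: cvgB; [exact: cvg_cst|exact: cvg_snd|
    exact: cvg_cst|exact: cvg_fst].
have : d z < e by rewrite /d !subrr normr0 addr0 mulr0.
move=> /(cvgr_lt _ dc); apply: filterS => w dw wS.
by apply: le_lt_trans dw; exact: fL.
Qed.

Lemma is_derive_lipschitz {R : realType} (f : R -> R) (x l L : R) :
  is_derive x 1 f l -> (\forall y \near x, `|f y - f x| <= L * `|y - x|) ->
  `|l| <= L.
Proof.
move=> /is_derive_slope fl fL.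
have fl' : `|(f s - f x) / (s - x)| @[s --> x^'] --> `|l| by exact: cvg_norm.
rewrite -(cvg_lim _ fl')//; apply: limr_le; first by apply/cvg_ex; exists `|l|.
rewrite near_withinE; apply: filterS fL => y fy yx.
by rewrite normrM normfV ler_pdivrMr// normr_gt0 subr_eq0.
Qed.

(** The penalisation parameters appear only as [delta] and [H], while the constants [nu], [K], [N],
    [C], [L] can be fixed beforehand. Since [H] vanishes on slopes up to [al], functions built from
    [g] feel no gradient penalty. *)
Record penalised_data {R : realType} (T r delta al nu K N C L : R)
    (A B : R -> R) (g h : R * R -> R) (H : R -> R) : Prop := {
  pd_T : 0 < T;
  pd_r : 0 <= r;
  pd_delta : 0 < delta;
  pd_al : 0 < al;
  pd_nu : 0 < nu;
  pd_K : 0 <= K;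
  pd_N : 0 <= N;
  pd_L : 0 <= L;
  pd_A : forall x, 0 <= x -> nu <= A x <= K;
  pd_B : forall x, 0 <= x -> `|B x| <= K;
  pd_gh : forall z, cl_strip T z -> [/\ 0 <= g z, 0 <= h z & g z + h z <= N];
  pd_g_derivs : has_derivs12 T (cl_strip T) g;
  pd_g_lip : forall z w, cl_strip T z -> cl_strip T w ->
    `|g z - g w| <= al * (`|z.2 - w.2| + `|z.1 - w.1|);
  pd_g_bound : forall z, cl_strip T z ->
    `|dt T g z| + K * `|dx g z| + K * `|dxx g z| + r * N + N + al <= C;
  pd_h_lip : forall t s x, 0 <= t <= T -> 0 <= s <= T -> 0 <= x ->
    `|h (t, x) - h (s, x)| <= L * `|t - s|;
  pd_H_ge0 : forall p, 0 <= H p;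
  pd_H_eq0 : forall p, `|p| <= al -> H p = 0;
  pd_H_convex : forall th p q, 0 <= th <= 1 ->
    H (th * p + (1 - th) * q) <= th * H p + (1 - th) * H q }.

Record classical_solution {R : realType} (T r delta K3 : R) (A B : R -> R)
    (g h : R * R -> R) (H : R -> R) (u : R * R -> R) : Prop := {
  cs_cont : {within cl_strip T, continuous u};
  cs_derivs : has_derivs12 T (strip T) u;
  cs_eq : forall z, strip T z ->
    penalised_op r delta A B g h H z (u z) (dt T u z) (dx u z) (dxx u z) = 0;
  cs_terminal : forall x, 0 <= x -> u (T, x) = g (T, x);
  cs_lateral : forall t, 0 <= t <= T -> u (t, 0) = g (t, 0);
  cs_ge0 : forall z, cl_strip T z -> 0 <= u z;
  cs_growth : forall z, cl_strip T z -> u z <= K3 * (1 + z.2 ^+ 2) }.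

Lemma strip_cl {R : realType} (T : R) z : strip T z -> cl_strip T z.
Proof. by move=> /andP[/andP[z0 zT] x0]; rewrite /cl_strip/= z0 !ltW. Qed.

Lemma continuous_addt {R : realType} (m p : R) (A : set (R * R)) (f : R * R -> R) :
  {within A, continuous f} ->
  {within A, continuous (fun w => f w + (m + p * w.1))}.
Proof.
move=> fc w; apply: cvgD; first exact: fc.
apply: (@continuous_subspaceT _ _ _ (fun w : R * R => m + p * w.1)) => {}w.
by apply: cvgD; [exact: cvg_cst|apply: cvgM; [exact: cvg_cst|exact: cvg_fst]].
Qed.

Lemma ler_coef_mul {R : realDomainType} (K a b : R) : `|a| <= K ->
  - (K * `|b|) <= a * b <= K * `|b|.
Proof. by move=> aK; rewrite -ler_norml normrM ler_wpM2r. Qed.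

Lemma dx_lipschitz {R : realType} (T L t x : R) (g : R * R -> R) :
  0 <= t <= T -> 0 < x -> has_dx g (t, x) ->
  (forall z w, cl_strip T z -> cl_strip T w ->
     `|g z - g w| <= L * (`|z.2 - w.2| + `|z.1 - w.1|)) ->
  `|dx g (t, x)| <= L.
Proof.
move=> tT x0 gx gL.
apply: (is_derive_lipschitz (@derive_within_interior _ (fun y => g (t, y)) _ x0 gx)).
have : x \in `]0, +oo[ by rewrite in_itv/= x0.
move/near_in_itvoy; apply: filterS => y; rewrite in_itv/= andbT => y0.
have yS : cl_strip T (t, y) by rewrite /cl_strip/= tT ltW.
have xS : cl_strip T (t, x) by rewrite /cl_strip/= tT ltW.
by have := gL _ _ yS xS; rewrite /= subrr normr0 addr0.
Qed.

Section penalised_estimates.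
Context {R : realType} {T r delta al nu K N C L K3 : R} {A B : R -> R}
  {g h : R * R -> R} {H : R -> R} {u : R * R -> R}.
Context (D : penalised_data T r delta al nu K N C L A B g h H)
  (U : classical_solution T r delta K3 A B g h H u).

Let op := penalised_op r delta A B g h H.
Let T0 : 0 < T. Proof. exact: pd_T D. Qed.
Let r0 : 0 <= r. Proof. exact: pd_r D. Qed.
Let d0 : 0 < delta. Proof. exact: pd_delta D. Qed.
Let N0 : 0 <= N. Proof. exact: pd_N D. Qed.
Let K0 : 0 <= K. Proof. exact: pd_K D. Qed.

Lemma pd_C_ge : al + N <= C.
Proof.
have z0 : cl_strip T (0, 0) by rewrite /cl_strip/= lexx ltW.
have := pd_g_bound D z0; have := mulr_ge0 r0 N0.
have := mulr_ge0 K0 (normr_ge0 (dx g (0, 0))).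
have := mulr_ge0 K0 (normr_ge0 (dxx g (0, 0))).
by have := normr_ge0 (dt T g (0, 0)); lra.
Qed.

Lemma pd_dt_lip t s x : 0 <= t <= T -> 0 <= s <= T -> 0 <= x ->
  `|g (t, x) - g (s, x)| <= al * `|t - s|.
Proof.
move=> tT sT x0; have := pd_g_lip D (_ : cl_strip T (t, x)) (_ : cl_strip T (s, x)).
by rewrite /cl_strip/= tT sT x0 subrr normr0 add0r; apply.
Qed.

Lemma pd_comparison (S M : R) (u1 u2 : R * R -> R) : 0 <= S <= T -> 0 <= M ->
  {within cl_strip S, continuous u1} -> {within cl_strip S, continuous u2} ->
  (forall z, cl_strip S z -> `|u1 z| <= M /\ `|u2 z| <= M) ->
  (forall x, 0 <= x -> u1 (S, x) <= u2 (S, x)) ->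
  (forall t, 0 <= t <= S -> u1 (t, 0) <= u2 (t, 0)) ->
  (forall z, strip S z -> exists a b c, heat_jet u1 z a b c /\
     op z (u1 z) a b c <= 0) ->
  (forall z, strip S z -> exists a b c, heat_jet u2 z a b c /\
     0 <= op z (u2 z) a b c) ->
  forall z, cl_strip S z -> u1 z <= u2 z.
Proof.
move=> /andP[S0 ST] M0; apply: (@comparison_principle _ S r delta K M al) => //.
- exact: pd_al D.
- by move=> x /(pd_A D)/andP[+ _]; apply: le_trans; exact: ltW (pd_nu D).
- exact: pd_B D.
- move=> z /andP[/andP[z0 zS] zx].
  have [] // := pd_gh D (_ : cl_strip T z).
  by rewrite /cl_strip/= z0 !ltW//= (lt_le_trans zS).
- by rewrite (pd_H_eq0 D)// normrN gtr0_norm// (pd_al D).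
- exact: pd_H_convex D.
Qed.

Lemma cs_jet z : strip T z -> heat_jet u z (dt T u z) (dx u z) (dxx u z).
Proof. exact: heat_jet_strip (cs_derivs U). Qed.

(** Upgrades quadratic growth to the boundedness required by the comparison principle. Where
    [u > N >= g] the obstacle term vanishes, and since [H] and [r * u] are nonnegative the remaining
    second-order expression is at most [h <= N]. *)
Lemma cs_upper z : cl_strip T z -> u z <= N * (1 + T).
Proof.
move=> zT.
have /andP[/andP[z0 _] _] := zT.
have gN t x : 0 <= t <= T -> 0 <= x -> g (t, x) <= N.
  move=> tT x0; have [] := pd_gh D (_ : cl_strip T (t, x)).
    by rewrite /cl_strip/= tT.
  by lra.
apply: (@le_trans _ _ (N * (1 + T - z.1))); last by rewrite ler_wpM2l//; lra.
apply: (@linear_growth_bound _ T K N K3 A B u) => //.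
- exact: ltW.
- move=> x /(pd_A D)/andP[+ ->]; rewrite andbT; apply: le_trans.
  exact: ltW (pd_nu D).
- exact: pd_B D.
- exact: cs_cont U.
- by move=> x x0; rewrite (cs_terminal U)// gN// lexx ltW.
- by move=> t tT; rewrite (cs_lateral U)// gN.
- exact: cs_growth U.
- move=> w wT Nu; exists (dt T u w), (dx u w), (dxx u w).
  split; first exact: cs_jet.
  have [g0 h0 ghN] := pd_gh D (strip_cl wT).
  have := cs_eq U wT; rewrite /penalised_op.
  have -> : Num.max (g w - u w) 0 = 0 by rewrite max_r//; lra.
  have := pd_H_ge0 D (dx u w).
  have := mulr_ge0 r0 (cs_ge0 U (strip_cl wT)).
  by rewrite mulr0; lra.
Qed.

Lemma cs_norm z : cl_strip T z -> `|u z| <= N * (1 + T).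
Proof. by move=> zT; rewrite ger0_norm ?(cs_ge0 U)//; exact: cs_upper. Qed.

(** Coefficients and derivatives are taken at separate points, and [a] may be 0, because the
    barriers freeze [g] at time [T]. The slack [r * N + N + al] absorbs the discount, the running
    payoff and the Lipschitz constant of [g]. *)
Lemma pd_gen_bound (z z' : R * R) (a : R) :
  cl_strip T z -> 0 <= z'.2 -> `|a| <= `|dt T g z| ->
  `|- a - A z'.2 * dxx g z - B z'.2 * dx g z| + r * N + N + al <= C.
Proof.
move=> zT z'0 ag; have := pd_g_bound D zT.
have AK : `|A z'.2| <= K.
  have /andP[? ?] := pd_A D z'0.
  by rewrite ger0_norm// (le_trans _ (_ : nu <= _))// ltW// (pd_nu D).
have := ler_coef_mul (dxx g z) AK; have := ler_coef_mul (dx g z) (pd_B D z'0).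
move: ag; rewrite ler_norml => /andP[? ?] /andP[? ?] /andP[? ?] ?.
suff : `|- a - A z'.2 * dxx g z - B z'.2 * dx g z| <=
    `|dt T g z| + K * `|dx g z| + K * `|dxx g z| by lra.
by rewrite ler_norml; lra.
Qed.

(** For [g - C * delta] the obstacle term is exactly [C], which pays for the remaining terms of the
    operator; the gradient penalty is zero on it. *)
Lemma cs_obstacle z : cl_strip T z -> g z - C * delta <= u z.
Proof.
move=> zT; have Cal := pd_C_ge; have al0 := pd_al D.
have N00 := pd_N D; have T00 := pd_T D.
have C0 : 0 <= C by lra.
have Cd := mulr_ge0 C0 (ltW d0).
suff : g z + (- (C * delta) + 0 * z.1) <= u z by lra.
have NT := mulr_ge0 N0 (ltW T0).
apply: (@pd_comparison T (N * (1 + T) + C * delta)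
  (fun z => g z + (- (C * delta) + 0 * z.1)) u) zT.
- by rewrite lexx ltW.
- lra.
- by apply: continuous_addt; exact: lipschitz_within_continuous (pd_g_lip D).
- exact: cs_cont U.
- move=> w wT; have [g0 h0 ghN] := pd_gh D wT; split.
    by rewrite ler_norml; lra.
  by have := cs_norm wT; lra.
- by move=> x x0; rewrite (cs_terminal U)//; lra.
- by move=> t tT; rewrite (cs_lateral U)//; lra.
- move=> w wT; have wT' := strip_cl wT.
  have /andP[/andP[w0 w1] w2] := wT.
  exists (dt T g w + 0), (dx g w), (dxx g w); split.
    apply: heat_jet_addt; apply: heat_jet_strip wT => y /strip_cl.
    exact: (pd_g_derivs D).
  have [g0 h0 ghN] := pd_gh D wT'.
  rewrite /op /penalised_op (pd_H_eq0 D); last first.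
    have [_ gx _] := pd_g_derivs D wT'.
    case: (w) gx w0 w1 w2 => t x /= gx w0 w1 w2.
    by apply: dx_lipschitz gx (pd_g_lip D) => //; rewrite w0 ltW.
  have -> : g w - (g w + (- (C * delta) + 0 * w.1)) = C * delta by ring.
  rewrite max_l//.
  have -> : delta^-1 * (C * delta) = C by field; rewrite gt_eqF.
  have := @pd_gen_bound w w _ wT' (ltW w2) (lexx _).
  have := ler_norm (- dt T g w - A w.2 * dxx g w - B w.2 * dx g w).
  have := ler_wpM2l r0 (_ : g w <= N); have := mulr_ge0 r0 Cd.
  have gN : g w <= N by lra.
  by move=> rCd /(_ gN); lra.
- move=> w wT; exists (dt T u w), (dx u w), (dxx u w).
  by split; [exact: cs_jet | rewrite /op (cs_eq U)].
Qed.

Lemma cs_near_terminal z : cl_strip T z -> `|u z - g (T, z.2)| <= C * (T - z.1).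
Proof.
move=> zT; have Cal := pd_C_ge; have al0 := pd_al D.
have N00 := pd_N D; have T00 := pd_T D.
have C0 : 0 <= C by lra.
have NT := mulr_ge0 N0 (ltW T0); have CT := mulr_ge0 C0 (ltW T0).
have TT x : 0 <= x -> cl_strip T (T, x) by move=> x0; rewrite /cl_strip/= ltW// lexx.
have Gc : {within cl_strip T, continuous (fun w : R * R => g (T, w.2))}.
  apply: (@lipschitz_within_continuous _ _ al) => y w /andP[_ y2] /andP[_ w2].
  apply: (le_trans (pd_g_lip D (TT _ y2) (TT _ w2))).
  by rewrite ler_pM2l//= subrr normr0 lerD2l.
have Gn w : cl_strip T w -> 0 <= g (T, w.2) <= N.
  by move=> /andP[_ w2]; have [] := pd_gh D (TT _ w2); lra.
have tn t : 0 <= t <= T -> 0 <= C * t <= C * T.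
  by move=> /andP[t0 tT]; rewrite mulr_ge0//= ler_wpM2l.
have un w : cl_strip T w -> `|u w| <= N * (1 + T) + C * T.
  by move=> wT; have := cs_norm wT; lra.
have gt w : 0 <= w.1 <= T -> 0 <= w.2 ->
    `|g w - g (T, w.2)| <= C * (T - w.1).
  case: w => t x /= tT x0; have := @pd_dt_lip t T x tT _ x0.
  rewrite lexx ltW// => /(_ isT) h1; apply: (le_trans h1).
  have /andP[? tT'] := tT.
  by rewrite distrC ger0_norm ?subr_ge0// ler_wpM2r ?subr_ge0//; lra.
have Gj m p w : strip T w -> heat_jet (fun w => g (T, w.2) + (m + p * w.1)) w
    (0 + p) (dx g (T, w.2)) (dxx g (T, w.2)).
  move=> /andP[_ w2]; apply: heat_jet_addt; apply: heat_jet_terminal => //.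
    exact: ltW.
  exact: pd_g_derivs D.
have Hb w : strip T w -> H (dx g (T, w.2)) = 0.
  move=> /andP[_ w2]; apply: (pd_H_eq0 D).
  have [_ gx _] := pd_g_derivs D (TT _ (ltW w2)).
  by apply: dx_lipschitz gx (pd_g_lip D) => //; rewrite lexx ltW.
have gb w := @pd_gen_bound (T, w.2) w 0.
have lo : g (T, z.2) + (- (C * T) + C * z.1) <= u z.
  apply: (@pd_comparison T (N * (1 + T) + C * T)
    (fun z => g (T, z.2) + (- (C * T) + C * z.1)) u) zT.
  - by rewrite lexx ltW.
  - lra.
  - exact: continuous_addt.
  - exact: cs_cont U.
  - move=> w wT; have /andP[/tn wt _] := wT; split; last exact: un.
    by have := Gn _ wT; rewrite ler_norml; lra.
  - by move=> x x0; rewrite (cs_terminal U)//=; lra.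
  - move=> t tT; rewrite (cs_lateral U)//=.
    by have := gt (t, 0) tT (lexx _); rewrite /= ler_norml; lra.
  - move=> w wT; have /andP[_ w2] := wT; have wT' := strip_cl wT.
    exists (0 + C), (dx g (T, w.2)), (dxx g (T, w.2)); split; first exact: Gj.
    have [g0 h0 ghN] := pd_gh D wT'.
    have /andP[/tn wt _] := wT'; have Gw := Gn _ wT'.
    rewrite /op /penalised_op Hb//.
    have : 0 <= delta^-1 * Num.max
        (g w - (g (T, w.2) + (- (C * T) + C * w.1))) 0.
      by rewrite mulr_ge0 ?invr_ge0 ?(ltW d0)// le_max lexx orbT.
    have := gb w (TT _ (ltW w2)) (ltW w2); rewrite normr0 => /(_ (normr_ge0 _)).
    have := ler_norm (- 0 - A w.2 * dxx g (T, w.2) - B w.2 * dx g (T, w.2)).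
    have vN : g (T, w.2) + (- (C * T) + C * w.1) <= N by lra.
    by have := ler_wpM2l r0 vN; lra.
  - move=> w wT; exists (dt T u w), (dx u w), (dxx u w).
    by split; [exact: cs_jet | rewrite /op (cs_eq U)].
have hi : u z <= g (T, z.2) + (C * T + (- C) * z.1).
  apply: (@pd_comparison T (N * (1 + T) + C * T) u
    (fun z => g (T, z.2) + (C * T + (- C) * z.1))) zT.
  - by rewrite lexx ltW.
  - lra.
  - exact: cs_cont U.
  - exact: continuous_addt.
  - move=> w wT; have /andP[/tn wt _] := wT; split; first exact: un.
    by have := Gn _ wT; rewrite ler_norml; lra.
  - by move=> x x0; rewrite (cs_terminal U)//=; lra.
  - move=> t tT; rewrite (cs_lateral U)//=.
    by have := gt (t, 0) tT (lexx _); rewrite /= ler_norml; lra.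
  - move=> w wT; exists (dt T u w), (dx u w), (dxx u w).
    by split; [exact: cs_jet | rewrite /op (cs_eq U)].
  - move=> w wT; have /andP[_ w2] := wT; have wT' := strip_cl wT.
    exists (0 + - C), (dx g (T, w.2)), (dxx g (T, w.2)); split; first exact: Gj.
    have [g0 h0 ghN] := pd_gh D wT'.
    have /andP[wtT wx0] := wT'; have wt := tn _ wtT; have Gw := Gn _ wT'.
    rewrite /op /penalised_op Hb// max_r; last first.
      by have := gt w wtT wx0; rewrite ler_norml; lra.
    have := gb w (TT _ (ltW w2)) (ltW w2); rewrite normr0 => /(_ (normr_ge0 _)).
    have := ler_norm (- (- 0 - A w.2 * dxx g (T, w.2) - B w.2 * dx g (T, w.2))).
    rewrite normrN.
    have v0 : 0 <= g (T, w.2) + (C * T + (- C) * w.1) by lra.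
    by have := mulr_ge0 r0 v0; have := mulr_ge0 r0 N0; lra.
by rewrite ler_norml; lra.
Qed.

Lemma max0_lip (a b c : R) : a <= b + c -> 0 <= c ->
  Num.max a 0 <= Num.max b 0 + c.
Proof.
move=> abc c0; rewrite ge_max; apply/andP; split.
  by apply: (le_trans abc); rewrite lerD2r le_max lexx.
by rewrite addr_ge0// le_max lexx orbT.
Qed.

(** In the correction [s * C + s * L * (T - t)] the constant part absorbs the change of [g] in the
    obstacle and on the lateral boundary, as well as the terminal gap. The time derivative of the
    other part absorbs the change of [h]. *)
Lemma cs_time_shift s z : 0 <= s <= T -> cl_strip (T - s) z ->
  `|u (z.1 + s, z.2) - u z| <= s * (C + L * T).
Proof.
move=> /andP[s0 sT] zT; have Cal := pd_C_ge; have al0 := pd_al D.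
have N00 := pd_N D; have T00 := pd_T D; have L0 := pd_L D; have r00 := pd_r D.
have C0 : 0 <= C by lra.
pose q := s * (C + L * T).
have sC : 0 <= s * C by rewrite mulr_ge0.
have sL : 0 <= s * L by rewrite mulr_ge0.
have al_sC : al * s <= s * C by rewrite mulrC ler_wpM2l//; lra.
have NT : 0 <= N * T by rewrite mulr_ge0// ltW.
have qt t : 0 <= t <= T -> 0 <= s * L * t <= s * L * T.
  by move=> /andP[t0 tT]; rewrite mulr_ge0//= ler_wpM2l.
have qE : q = s * C + s * L * T by rewrite /q; ring.
have inT w : cl_strip (T - s) w -> cl_strip T w /\ cl_strip T (w.1 + s, w.2).
  move=> /andP[/andP[w0 w1] w2]; rewrite /cl_strip/= w2 w0 !andbT.
  by split; [lra|apply/andP; split; lra].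
have inT' w : strip (T - s) w -> strip T w /\ strip T (w.1 + s, w.2).
  move=> /andP[/andP[w0 w1] w2]; rewrite /strip/= w2 w0 !andbT.
  by split; [lra|apply/andP; split; lra].
have wt w : cl_strip T w -> 0 <= s * L * w.1 <= s * L * T.
  by move=> /andP[w1 _]; exact: qt.
have S01 : 0 <= T - s <= T by lra.
have uc' : {within cl_strip (T - s), continuous (fun w => u (w.1 + s, w.2))}.
  apply: (@continuous_within_comp _ _ _ _ (cl_strip T)
    (fun w : R * R => (w.1 + s, w.2)) u); last exact: cs_cont U.
    by move=> w /inT[].
  move=> w; apply: (@cvg_pair _ _ _ _ (nbhs (w.1 + s)) (nbhs w.2)); last exact: cvg_snd.
  by apply: cvgD; [exact: cvg_fst|exact: cvg_cst].
have uc : {within cl_strip (T - s), continuous u}.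
  by apply: continuous_subspaceW (cs_cont U) => w /inT[].
have uj w : strip (T - s) w -> exists a b c, heat_jet u w a b c /\ op w (u w) a b c = 0.
  move=> /inT'[wT _]; exists (dt T u w), (dx u w), (dxx u w).
  by split; [exact: cs_jet | rewrite /op (cs_eq U)].
have gs w : cl_strip (T - s) w -> `|g (w.1 + s, w.2) - g w| <= s * C.
  case: w => t x /inT[/andP[/= tT x0] /andP[/= tsT _]].
  apply: (le_trans (@pd_dt_lip _ _ _ tsT tT x0)).
  by rewrite addrAC subrr add0r ger0_norm.
have hs w : cl_strip (T - s) w -> `|h (w.1 + s, w.2) - h w| <= s * L.
  case: w => t x /inT[/andP[/= tT x0] /andP[/= tsT _]].
  apply: (le_trans (@pd_h_lip _ _ _ _ _ _ _ _ _ _ _ _ _ _ _ D _ _ _ tsT tT x0)).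
  by rewrite addrAC subrr add0r ger0_norm// mulrC.
(* On the last slice of the shortened strip the shifted function is the terminal datum, so the
   barrier estimate applies at time [T - s]. *)
have uend x : 0 <= x -> `|u (T, x) - u (T - s, x)| <= s * C.
  move=> x0; have := @cs_near_terminal (T - s, x).
  rewrite /cl_strip/= x0 (cs_terminal U)// distrC andbT => /(_ S01).
  by rewrite subKr mulrC.
pose M := N * (1 + T) + q.
have bnd w : cl_strip (T - s) w -> `|u w| <= M /\
    `|u (w.1 + s, w.2) + (q + - (s * L) * w.1)| <= M /\
    `|u (w.1 + s, w.2) + (- q + s * L * w.1)| <= M.
  move=> /inT[wT wsT]; have := cs_norm wT; have := cs_norm wsT; have := wt _ wT.
  by rewrite /M !ler_norml; lra.
have sLT : 0 <= s * L * T by rewrite mulr_ge0// ltW.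
have M0 : 0 <= M by rewrite /M; lra.
have jet m p w : strip (T - s) w ->
    heat_jet (fun w => u (w.1 + s, w.2) + (m + p * w.1)) w
      (dt T u (w.1 + s, w.2) + p) (dx u (w.1 + s, w.2)) (dxx u (w.1 + s, w.2)).
  move=> /inT'[_ wT]; apply: heat_jet_addt; case: w wT => t x wT.
  by apply: heat_jet_shift; exact: cs_jet.
have hi : u z <= u (z.1 + s, z.2) + (q + - (s * L) * z.1).
  apply: (@pd_comparison (T - s) M u
    (fun w => u (w.1 + s, w.2) + (q + - (s * L) * w.1))) zT => //.
  - exact: continuous_addt.
  - by move=> w /bnd[? []].
  - move=> x x0; rewrite /= subrK; have := uend x x0; have := qt _ S01.
    by rewrite ler_norml; lra.
  - move=> t tS; have tS' : cl_strip (T - s) (t, 0) by rewrite /cl_strip/= tS lexx.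
    have [/andP[/= tT _] /andP[/= tsT _]] := inT _ tS'.
    rewrite /= !(cs_lateral U)//; have := gs _ tS'; have := qt _ tT.
    by rewrite /= ler_norml; lra.
  - by move=> w /uj[a [b [c [? E]]]]; exists a, b, c; rewrite E.
  - move=> w wS; have [/strip_cl wT wsT] := inT' _ wS; have wS' := strip_cl wS.
    do 3 eexists; split; first exact: jet.
    have := cs_eq U wsT; have := hs _ wS'; have := gs _ wS'; have := wt _ wT.
    rewrite /op /penalised_op /= !ler_norml.
    set u' := u _; set g' := g (_, _); set h' := h (_, _).
    set v := u' + _ => wt' gs' hs' eq0.
    have v0 : 0 <= v - u' by rewrite /v; lra.
    have mm : Num.max (g w - v) 0 <= Num.max (g' - u') 0.
      have := @max0_lip (g w - v) (g' - u') 0; rewrite !addr0; apply => //.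
      by rewrite /v; lra.
    have := ler_wpM2l (_ : 0 <= delta^-1) mm.
    rewrite invr_ge0 (ltW (pd_delta D)) => /(_ isT).
    by have := mulr_ge0 r00 v0; lra.
have lo : u (z.1 + s, z.2) + (- q + s * L * z.1) <= u z.
  apply: (@pd_comparison (T - s) M
    (fun w => u (w.1 + s, w.2) + (- q + s * L * w.1)) u) zT => //.
  - exact: continuous_addt.
  - by move=> w /bnd[? []].
  - move=> x x0; rewrite /= subrK; have := uend x x0; have := qt _ S01.
    by rewrite ler_norml; lra.
  - move=> t tS; have tS' : cl_strip (T - s) (t, 0) by rewrite /cl_strip/= tS lexx.
    have [/andP[/= tT _] /andP[/= tsT _]] := inT _ tS'.
    rewrite /= !(cs_lateral U)//; have := gs _ tS'; have := qt _ tT.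
    by rewrite /= ler_norml; lra.
  - move=> w wS; have [/strip_cl wT wsT] := inT' _ wS; have wS' := strip_cl wS.
    do 3 eexists; split; first exact: jet.
    have := cs_eq U wsT; have := hs _ wS'; have := gs _ wS'; have := wt _ wT.
    rewrite /op /penalised_op /= !ler_norml.
    set u' := u _; set g' := g (_, _); set h' := h (_, _).
    set v := u' + _ => wt' gs' hs' eq0.
    have v0 : 0 <= u' - v by rewrite /v; lra.
    have mm : Num.max (g' - u') 0 <= Num.max (g w - v) 0.
      have := @max0_lip (g' - u') (g w - v) 0; rewrite !addr0; apply => //.
      by rewrite /v; lra.
    have := ler_wpM2l (_ : 0 <= delta^-1) mm.
    rewrite invr_ge0 (ltW (pd_delta D)) => /(_ isT).
    by have := mulr_ge0 r00 v0; lra.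
  - by move=> w /uj[a [b [c [? E]]]]; exists a, b, c; rewrite E.
have [zT' _] := inT _ zT; have := wt _ zT'.
by rewrite -/q ler_norml; lra.
Qed.

Lemma cs_time_lipschitz t s x : 0 <= t <= T -> 0 <= s <= T -> 0 <= x ->
  `|u (t, x) - u (s, x)| <= (C + L * T) * `|t - s|.
Proof.
wlog st : t s / s <= t.
  move=> W tT sT x0; case: (leP s t) => [st|/ltW st]; first exact: W.
  by rewrite distrC (distrC t); exact: W.
move=> tT sT x0; have ts : 0 <= t - s by rewrite subr_ge0.
have := @cs_time_shift (t - s) (s, x).
rewrite /= (addrC s) subrK (ger0_norm ts) (mulrC (t - s)); apply; first by lra.
by rewrite /cl_strip/= x0; lra.
Qed.

Lemma cs_dt_bound z : strip T z -> `|dt T u z| <= C + L * T.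
Proof.
case: z => t x zT; have [ut _] := cs_jet zT.
have /andP[/andP[/= t0 tT] x0] := zT.
have ut' : `|(u (s, x) - u (t, x)) / (s - t)| @[s --> t^'+] --> `|dt T u (t, x)|.
  exact: cvg_norm ut.
rewrite -(cvg_lim _ ut')//; apply: limr_le.
  by apply/cvg_ex; exists `|dt T u (t, x)|.
near=> s.
have ts : t < s by near: s; exact: nbhs_right_gt.
have sT : s <= T by near: s; exact: nbhs_right_le.
rewrite normrM normfV ler_pdivrMr ?normr_gt0 ?subr_eq0 ?gt_eqF//.
have s0 : 0 <= s by rewrite (le_trans t0)// ltW.
by apply: cs_time_lipschitz; rewrite ?s0 ?t0 ?sT// ltW.
Unshelve. all: by end_near. Qed.

(** [C + L * T] bounds the time derivative, [K] the drift coefficient, [N] the running payoff and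
    the last [C] the obstacle term. *)
Let Lam := C + L * T + K + N + C.

Lemma cs_space_lipschitz t x y : 0 <= t <= T -> 0 <= x -> 0 <= y ->
  `|x - y| <= 1 ->
  `|u (t, x) - u (t, y)| <=
    (N * (1 + T) + Lam / nu + 1 + al) * expR (Lam / nu + 1) * `|x - y| + C * delta.
Proof.
move=> tT x0 y0 xy1; have Cal := pd_C_ge; have al0 := pd_al D.
have N00 := pd_N D; have T00 := pd_T D; have L0 := pd_L D; have r00 := pd_r D.
have K00 := pd_K D; have nu0 := pd_nu D.
have C0 : 0 <= C by lra.
have Cd : 0 <= C * delta by rewrite mulr_ge0// ltW// (pd_delta D).
have LT : 0 <= L * T by rewrite mulr_ge0// ltW.
have NT : 0 <= N * T by rewrite mulr_ge0// ltW.
have Lam0 : 0 <= Lam by rewrite /Lam; lra.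
have Ln : 0 <= Lam / nu by rewrite divr_ge0// ltW.
have tS z : 0 <= z -> cl_strip T (t, z) by move=> z0; rewrite /cl_strip/= tT.
have gL a b : 0 <= a -> 0 <= b -> `|g (t, a) - g (t, b)| <= al * `|a - b|.
  move=> a0 b0; have := pd_g_lip D (tS _ a0) (tS _ b0).
  by rewrite /= subrr normr0 addr0.
have [tE|tT'] := eqVneq t T.
  have uT z : 0 <= z -> u (t, z) = g (t, z) by move=> z0; rewrite tE (cs_terminal U).
  rewrite !uT// (le_trans (gL _ _ x0 y0))//.
  rewrite ler_wpDr// ler_wpM2r//.
  have P0 : 0 <= N * (1 + T) + Lam / nu + 1 + al by lra.
  have e1 : 1 <= expR (Lam / nu + 1) by have := expR_ge1Dx (Lam / nu + 1); lra.
  by have := ler_wpM2l P0 e1; lra.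
have tS' z : 0 < z -> strip T (t, z).
  move=> z0; have /andP[t0 tT1] := tT.
  by rewrite /strip/= t0 z0 lt_neqAle tT' tT1.
apply: (@semiconvex_lipschitz _ (Lam / nu) (N * (1 + T)) al (C * delta)
  (fun y => u (t, y)) (fun y => dx u (t, y)) (fun y => dxx u (t, y))) => //.
- exact: ltW.
- apply: (@continuous_within_comp _ _ _ _ (cl_strip T)
    (fun y : R => (t, y)) u); last exact: cs_cont U.
    by move=> z; rewrite /= in_itv/= andbT => /tS.
  move=> z; apply: (@cvg_pair _ _ _ _ (nbhs t) (nbhs z)); last exact: cvg_id.
  exact: cvg_cst.
- by move=> z z0; rewrite (cs_ge0 U) ?cs_upper//; exact: tS.
(* The comparison with the value at 0 comes from [u (t, 0) = g (t, 0)] and [u >= g - C * delta];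
   this is the origin of the error term. *)
- move=> z z0; rewrite (cs_lateral U)//; have := gL 0 z (lexx _) z0.
  rewrite sub0r normrN (ger0_norm z0) ler_norml.
  by have := cs_obstacle (tS _ z0); lra.
- move=> z z0; have zT := tS' _ z0; have [_ [f1 ff1 [f1b f1c]]] := cs_jet zT.
  have [ut ux uxx] := cs_derivs U zT.
  have ux' (w : R) : 0 < w -> is_derive w 1 (fun y => u (t, y)) (dx u (t, w)).
    move=> w0; have [_ uw _] := cs_derivs U (tS' _ w0).
    exact: (@derive_within_interior _ (fun y => u (t, y))).
  split.
  + have : z \in `]0, +oo[ by rewrite in_itv/= z0.
    by move/near_in_itvoy; apply: filterS => w; rewrite in_itv/= andbT => /ux'.
  + exact: (@derive_within_interior _ (fun y => dx u (t, y))).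
  (* Only a negative second derivative needs an estimate; then [A >= nu] gives
     [A * u_xx <= nu * u_xx], and the equation can be divided by [nu]. *)
  + have [c0|c0] := leP 0 (dxx u (t, z)).
      by apply: le_trans c0; rewrite oppr_le0 mulr_ge0.
    have zT' := strip_cl zT; have [g0 h0 ghN] := pd_gh D zT'.
    have := cs_eq U zT; rewrite /penalised_op /=.
    have := pd_H_ge0 D (dx u (t, z)); have := mulr_ge0 r00 (cs_ge0 U zT').
    have := cs_dt_bound zT; rewrite ler_norml.
    have := ler_coef_mul (dx u (t, z)) (pd_B D (ltW z0)).
    have : delta^-1 * Num.max (g (t, z) - u (t, z)) 0 <= C.
      rewrite ler_pdivrMl ?(pd_delta D)// mulrC ge_max Cd andbT.
      by have := cs_obstacle zT'; lra.
    have /andP[nA _] := pd_A D (ltW z0).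
    have := ler_wnM2r (ltW c0) nA.
    move: (normr_ge0 (dx u (t, z))) => b0 ? ? /andP[? ?] /andP[? ?] ? ? ?.
    rewrite mulrAC -mulNr ler_pdivrMr// [leRHS]mulrC.
    have : 0 <= (C + L * T + N + C) * `|dx u (t, z)| by rewrite mulr_ge0//; lra.
    by rewrite /Lam; lra.
Qed.

End penalised_estimates.

(** * Passage to the limit *)

Lemma penalty_homo {R : realType} (e : R) (psi : R -> R) :
  penalty e psi -> {homo psi : x y / x <= y}.
Proof.
move=> P x y xy; apply: (@ger0_derive1_ndecr _ psi x y) => //.
- by move=> z _; exact: pen_derivable P z.
- by move=> z _; exact: pen_deriv_ge0 P z.
- by apply: derivable_within_continuous => z _; exact: pen_derivable P z.
Qed.

Lemma penalty_convexE {R : realType} (e : R) (psi : R -> R) (th x y : R) :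
  penalty e psi -> 0 <= th <= 1 ->
  psi (th * x + (1 - th) * y) <= th * psi x + (1 - th) * psi y.
Proof.
move=> P /andP[th0 th1].
have := pen_convex P (Itv01 th0 th1) (in_setT (x : R^o)) (in_setT (y : R^o)).
by rewrite !convRE.
Qed.

(** A nondecreasing convex function composed with a convex one; [th * (1 - th) * (p - q) ^+ 2] is
    the convexity gap of the square. *)
Lemma penalty_sqr_convex {R : realType} (e al : R) (psi : R -> R) (th p q : R) :
  penalty e psi -> 0 <= th <= 1 ->
  psi (`|th * p + (1 - th) * q| ^+ 2 - al ^+ 2) <=
  th * psi (`|p| ^+ 2 - al ^+ 2) + (1 - th) * psi (`|q| ^+ 2 - al ^+ 2).
Proof.
move=> P th01; apply: le_trans (penalty_convexE _ _ P th01).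
apply: (penalty_homo P); rewrite !real_normK ?num_real//.
have /andP[th0 th1] := th01.
have : 0 <= th * (1 - th) * (p - q) ^+ 2.
  by rewrite mulr_ge0 ?sqr_ge0// mulr_ge0// subr_ge0.
by lra.
Qed.

(** The order of quantifiers matters: the constants are produced before [e], [psi] and [delta],
    which makes every later estimate uniform in them. *)
Lemma approx_penalised_data {R : realType} (T r al gamma D1 Dg gs k : R) (N : nat)
    (g h gN hN : R * R -> R) (muk sigmak : R -> R) :
  0 < T -> 0 <= r -> 0 < al -> 0 < k ->
  approx_payoff T gamma g h N al gN hN ->
  approx_coeff D1 Dg gs k muk sigmak ->
  exists nu K C L, forall e psi delta, penalty e psi -> 0 < delta ->
    penalised_data T r delta al nu K N%:R C L
      (fun x => sigmak x ^+ 2 / 2) muk gN hN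
      (fun p => psi (`|p| ^+ 2 - al ^+ 2)).
Proof.
move=> T0 r0 al0 k0 P Q.
have [gd _ [_ [c1 dtg] [c2 dxg] [c3 dxxg]]] := ap_gN P.
have [L hL] := ap_hN_lip P.
(* One constant bounding both the halved squared volatility and the drift. *)
pose K := k^-1 ^+ 2 + k^-1.
have ki0 : 0 < k^-1 by rewrite invr_gt0.
have K0 : 0 <= K by rewrite addr_ge0 ?sqr_ge0// ltW.
(* The ellipticity constant comes from [sigmak >= k]. The modulus of [L] is taken because the
   Lipschitz constant of [hN] is given without a sign. *)
exists (k ^+ 2 / 2), K, (c1 + K * c2 + K * c3 + r * N%:R + N%:R + al), `|L|.
move=> e psi delta Pe d0; split => //.
- by rewrite divr_gt0// exprn_gt0.
- move=> x /(ac_sigma_bound Q)/andP[kx xk].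
  have s0 : 0 <= sigmak x by rewrite (le_trans _ kx)// ltW.
  have : k ^+ 2 <= sigmak x ^+ 2 by rewrite ler_sqr ?nnegrE// ltW.
  have : sigmak x ^+ 2 <= k^-1 ^+ 2 by rewrite ler_sqr ?nnegrE// ltW.
  by have := sqr_ge0 k^-1; rewrite /K; lra.
- move=> x /(ac_mu_bound Q) mk; apply: (le_trans mk).
  by rewrite lerDr sqr_ge0.
- move=> z zT; have /andP[g0 _] := ap_gN_le P zT.
  by have /andP[h0 _] := ap_hN_le P zT; split => //; exact: (ap_sum_le P).
- exact: ap_gN_lip P.
- move=> z zT; have := dtg z zT.
  have := ler_wpM2l K0 (dxg z zT); have := ler_wpM2l K0 (dxxg z zT).
  by lra.
- move=> t s x tT sT x0.
  have tS : cl_strip T (t, x) by rewrite /cl_strip/= tT.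
  have sS : cl_strip T (s, x) by rewrite /cl_strip/= sT.
  apply: (le_trans (hL _ _ tS sS)); rewrite /= subrr normr0 add0r.
  by rewrite ler_wpM2r// ler_norm.
- by move=> p; exact: pen_ge0 Pe _.
- move=> p pal; apply: (pen_eq0 Pe).
  by rewrite subr_le0 ler_sqr ?nnegrE// ltW.
- by move=> th p q; exact: penalty_sqr_convex Pe.
Qed.

Lemma penalised_classical_solution {R : realType} (T r gamma K3 al delta : R)
    (muk sigmak psi : R -> R) (gN hN u : R * R -> R) :
  penalised_solution T r gamma K3 al muk sigmak gN hN psi delta u ->
  classical_solution T r delta K3 (fun x => sigmak x ^+ 2 / 2) muk gN hN
    (fun p => psi (`|p| ^+ 2 - al ^+ 2)) u.
Proof.
move=> S; have [uc [ud _] _] := ps_class S; split => //.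
- move=> z zT; have := ps_eq S zT; rewrite /penalised_op /gen; lra.
- exact: ps_terminal S.
- exact: ps_lateral S.
- by move=> z /(ps_growth S)/andP[].
- by move=> z /(ps_growth S)/andP[_]; rewrite real_normK// num_real.
Qed.

(** Singletons are compact, so locally uniform convergence specialises to each point. *)
Lemma penalised_limit_cvg {R : realType} (T q : R) (ud : R -> R * R -> R) u :
  penalised_limit T q ud u -> exists delta : nat -> R,
  [/\ forall n, 0 < delta n < 1, delta @ \oo --> (0 : R) &
    forall z, cl_strip T z -> ud (delta n) z @[n --> \oo] --> u z].
Proof.
move=> [delta [d01 _ d0 _ dU]]; exists delta; split => // z zT.
have /dU : compact [set z] by exact: compact_set1.
rewrite uniform_set1; apply.
by move=> _ ->.
Qed.

Lemma ler_powR_unit {R : realType} (d a : R) : 0 <= d <= 1 -> 0 < a <= 1 ->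
  d <= d `^ a.
Proof.
move=> /andP[d0 d1] /andP[a0 a1].
have [->|dn0] := eqVneq d 0; first exact: powR_ge0.
by apply: ger1_powR => //; rewrite d1 lt_neqAle eq_sym dn0 d0.
Qed.

Lemma limit_lipschitz {R : realType} (T r al gamma D1 Dg gs K3 k q : R) (N : nat)
    (g h gN hN : R * R -> R) (muk sigmak : R -> R) (psi : R -> R -> R)
    (ud : R -> R -> R * R -> R) (u : R -> R * R -> R) :
  0 < T -> 0 <= r -> 0 < al -> 0 < k ->
  approx_payoff T gamma g h N al gN hN ->
  approx_coeff D1 Dg gs k muk sigmak ->
  (forall e, 0 < e < 1 -> penalty e (psi e)) ->
  (forall e delta, 0 < e < 1 -> 0 < delta < 1 ->
    penalised_solution T r gamma K3 al muk sigmak gN hN (psi e) delta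
      (ud e delta)) ->
  (forall e, 0 < e < 1 -> penalised_limit T q (ud e) (u e)) ->
  exists lambda P, [/\ 0 < lambda, 0 < P & forall e, 0 < e < 1 ->
    forall t s x y, 0 <= t <= T -> 0 <= s <= T -> 0 <= x -> 0 <= y ->
    `|x - y| <= 1 ->
    `|u e (t, x) - u e (s, y)| <= P * `|x - y| + lambda * `|t - s|].
Proof.
move=> T0 r0 al0 k0 Hp Hc Hpsi Hud Hu.
have [nu [K [C [L DD]]]] := approx_penalised_data T0 r0 al0 k0 Hp Hc.
(* The data are instantiated at an arbitrary parameter value, only to read off the signs of the
   constants. *)
have half01 : 0 < (2^-1 : R) < 1 by lra.
have /andP[half0 half1] := half01.
have D := DD _ _ _ (Hpsi _ half01) half0.
have Cal := pd_C_ge D.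
have N0 := pd_N D; have L0 := pd_L D; have K0 := pd_K D; have nu0 := pd_nu D.
have LT : 0 <= L * T by rewrite mulr_ge0// ltW.
have NT : 0 <= N%:R * T by rewrite mulr_ge0// ltW.
pose Lam := C + L * T + K + N%:R + C.
have Ln : 0 <= Lam / nu by rewrite divr_ge0 ?(ltW nu0)// /Lam; lra.
pose P := (N%:R * (1 + T) + Lam / nu + 1 + al) * expR (Lam / nu + 1).
exists (C + L * T), P; split.
- lra.
- by rewrite mulr_gt0 ?expR_gt0//; lra.
move=> e e01 t s x y tT sT x0 y0 xy.
have [delta [d01 dl uz]] := penalised_limit_cvg (Hu e e01).
have tx : cl_strip T (t, x) by rewrite /cl_strip/= tT.
have sy : cl_strip T (s, y) by rewrite /cl_strip/= sT.
have lhs : `|ud e (delta n) (t, x) - ud e (delta n) (s, y)| @[n --> \oo] -->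
    `|u e (t, x) - u e (s, y)|.
  by apply: cvg_norm; apply: cvgB; exact: uz.
pose B := P * `|x - y| + (C + L * T) * `|t - s|.
(* The error [C * delta n] of the space estimate disappears in the limit. *)
have rhs : B + C * delta n @[n --> \oo] --> B + C * 0.
  by apply: cvgD; [exact: cvg_cst|apply: cvgM; [exact: cvg_cst|exact: dl]].
rewrite -/B -[leRHS]addr0 -(mulr0 C).
apply: (ler_cvg_to lhs rhs); apply: nearW => n.
have [dn0 dn1] := andP (d01 n).
have Dn := DD _ _ _ (Hpsi _ e01) dn0.
have Un := penalised_classical_solution (Hud _ _ e01 (d01 n)).
have h1 := cs_space_lipschitz Dn Un tT x0 y0 xy.
have h2 := cs_time_lipschitz Dn Un tT sT y0.
apply: (le_trans (ler_distD (ud e (delta n) (t, y)) _ _)).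
apply: (le_trans (lerD h1 h2)).
by rewrite -/Lam -/P /B; lra.
Qed.

Theorem proposition5p2 (R : realType)
    (T r alpha gamma D1 Dg gs K0 K1 K2 K3 q : R)
    (mu sigma : R -> R) (g h : R * R -> R)
    (alphaN : nat -> R) (gN hN : nat -> R * R -> R)
    (muk sigmak : R -> R -> R) (psi : R -> R -> R)
    (T_gt0 : 0 < T) (r_ge0 : 0 <= r) (alpha_gt0 : 0 < alpha)
    (gamma01 : 0 < gamma < 1) (q_gt3 : 3 < q)
    (H_sde : sde_assumption D1 Dg gs mu sigma)
    (H_G : G_assumption T r alpha gamma K0 K1 K2 mu sigma g h)
    (H_payoff : \forall N \near \oo,
       approx_payoff T gamma g h N (alphaN N) (gN N) (hN N))
    (alphaN_noninc : nonincreasing_seq alphaN)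
    (alphaN_cvg : alphaN @ \oo --> alpha)
    (H_coeff : \forall k \near 0^'+,
       approx_coeff D1 Dg gs k (muk k) (sigmak k))
    (muk_cvg : cvg_unif_compacts muk mu)
    (sigmak_cvg : cvg_unif_compacts sigmak sigma)
    (H_psi : forall e, 0 < e < 1 -> penalty e (psi e)) :
  \forall N \near \oo & k \near 0^'+,
    forall (ud : R -> R -> R * R -> R) (u : R -> R * R -> R),
    (forall e delta, 0 < e < 1 -> 0 < delta < 1 ->
      unique_penalised_solution T r gamma K3 (alphaN N) (muk k) (sigmak k)
        (gN N) (hN N) (psi e) delta (ud e delta)) ->
    (forall e, 0 < e < 1 -> penalised_limit T q (ud e) (u e)) ->
    exists2 lambda : R, 0 < lambda &
    forall p : R, 1 < p ->
    exists2 c0 : R, 0 < c0 &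
    forall e, 0 < e < 1 ->
    forall t s x y : R, 0 <= t <= T -> 0 <= s <= T -> 0 <= x -> 0 <= y ->
      Num.max `|s - t| `|x - y| <= 1 ->
      `|u e (t, x) - u e (s, y)| <=
        c0 * `|x - y| `^ ((p - 1) / (4 * p)) + lambda * `|t - s|.
Proof.
(* A nonincreasing sequence stays above its limit [alpha > 0]. *)
have al_gt0 N : 0 < alphaN N.
  apply: (lt_le_trans alpha_gt0); rewrite -(cvg_lim _ alphaN_cvg)//.
  by apply: nonincreasing_cvgn_ge alphaN_noninc _ N; apply/cvg_ex; exists alpha.
exists ([set N | approx_payoff T gamma g h N (alphaN N) (gN N) (hN N)],
  [set k | 0 < k /\ approx_coeff D1 Dg gs k (muk k) (sigmak k)]) => /=.
  split => //=; near=> k; split; last by near: k.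
  by near: k; exact: nbhs_right_gt.
move=> [N k] /= [Hp [k0 Hc]] ud u Hud Hu.
have [lambda [P [lambda0 P0 HP]]] := limit_lipschitz T_gt0 r_ge0 (al_gt0 N) k0
  Hp Hc H_psi (fun e delta e01 d01 => (Hud e delta e01 d01).1) Hu.
(* The Lipschitz constant serves as [c0] for every [p]: the exponent lies in [(0, 1]], and a
   distance at most 1 is bounded by its power. *)
exists lambda => // p p1; exists P => // e e01 t s x y tT sT x0 y0.
rewrite ge_max => /andP[_ xy].
apply: (le_trans (HP e e01 t s x y tT sT x0 y0 xy)).
rewrite lerD2r ler_pM2l// ler_powR_unit// ?normr_ge0//.
have p4 : 0 < 4 * p by lra.
by rewrite divr_gt0 ?subr_gt0//= ler_pdivrMr// mul1r; lra.
Unshelve. all: by end_near. Qed.
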